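(* Let $p$ be a prime integer. Let $A$ be either $\mathbb{Z}$ or a discrete valuation ring with uniformizer $p$. Let $R$ be an essentially smooth $A$-algebra that has a $p$-derivation $\delta$. Let $Q$ be a prime ideal of $R$ that contains $p$, and assume that the field extension $A/pA \hookrightarrow R_Q/QR_Q$ is separable. Then $Q^{(n)} = Q^{\langle n\rangle_{\mathrm{mix}}}$ for all $n\ge 1$, where $Q^{\langle n\rangle_{\mathrm{mix}}}$ is the $n$-th mixed differential power of $Q$ with respect to $\delta$ and $A$.
   Context: All rings are commutative with identity. A ring $S$ is essentially smooth over a subring $B$ if the inclusion $B\to S$ is formally smooth and $S$ is a localization of a finitely generated $B$-algebra. Field extensions are not assumed algebraic; ''separable'' is in the general sense. For a prime ideal $Q$ of a ring $R$ and $n\ge 1$, the $n$-th symbolic power of $Q$ is $Q^{(n)} = Q^nR_Q\cap R$ (the preimage of $Q^nR_Q$ under $R\to R_Q$). For a ring map $A\to R$, the sets of $A$-linear differential operators on $R$ of order at most $n$ are defined inductively: $D^0_{R|A}=\mathrm{Hom}_R(R,R)\subseteq \mathrm{Hom}_A(R,R)$ (multiplications by elements of $R$), and for $n\ge 1$, $D^n_{R|A}=\{\partial\in \mathrm{Hom}_A(R,R) \mid [\partial,f]=\partial\circ f-f\circ\partial\in D^{n-1}_{R|A} \text{ for all } f\in D^0_{R|A}\}$. For a prime integer $p$ and a ring $R$ on which $p$ is a nonzerodivisor, a $p$-derivation on $R$ is a set-theoretic map $\delta:R\to R$ such that $x\mapsto x^p+p\,\delta(x)$ is a ring homomorphism $R\to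 R$. Write $\delta^s$ for the $s$-fold self-composition of $\delta$, with $\delta^0=\mathrm{id}$. (In the setting of the claim, $R$ is $p$-torsion free.) The $n$-th mixed differential power of an ideal $I$ of $R$ (with respect to $\delta$ and $A$) is $$I^{\langle n\rangle_{\mathrm{mix}}}=\{f\in R\mid (\delta^s\circ\partial)(f)\in I \text{ for all integers } s,t\ge 0 \text{ with } s+t\le n-1 \text{ and all } \partial\in D^t_{R|A}\}.$$ *)

(* Defs.v *)
(* Subsets and ideals are Prop-valued [set T] from mathcomp-classical. *)
From HB Require Import structures.
From mathcomp Require Import all_boot all_order all_algebra all_field.
From mathcomp Require Import mpoly.
From mathcomp Require Import boolp classical_sets.

Set Implicit Arguments.
Unset Strict Implicit.
Unset Printing Implicit Defensive.

Import GRing.Theory.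
Local Open Scope classical_set_scope.
Local Open Scope ring_scope.

Section Ideals.
Variable R : comNzRingType.
Implicit Types I J Q : set R.

(* Unlike [idealr_closed], this allows the unit ideal. *)
Definition is_ideal I : Prop :=
  [/\ I 0, forall x y, I x -> I y -> I (x + y) & forall a x, I x -> I (a * x)].

Definition is_prime_ideal Q : Prop :=
  [/\ is_ideal Q, ~ Q 1 & forall x y, Q (x * y) -> Q x \/ Q y].

Definition is_maximal_ideal I : Prop :=
  [/\ is_ideal I, ~ I 1 & forall J, is_ideal J -> I `<=` J -> J = I \/ J 1].

Definition ideal_span (X : set R) : set R :=
  [set x | forall J, is_ideal J -> X `<=` J -> J x].

Definition principal (a : R) : set R := ideal_span [set a].

Definition ideal_power I (n : nat) : set R :=
  ideal_span [set x | exists2 f : 'I_n -> R,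
                        forall i, I (f i) & x = \prod_(i < n) f i].

End Ideals.

Definition discrete_valuation_ring (A : idomainType) : Prop :=
  [/\ forall I : set A, is_ideal I -> exists a, I = principal a,
      exists! m : set A, is_maximal_ideal m
    & ~ is_maximal_ideal [set (0 : A)]].

Definition is_uniformizer (A : idomainType) (t : A) : Prop :=
  is_maximal_ideal (principal t).

Definition is_ring_Z (A : idomainType) : Prop :=
  bijective (fun m : int => m%:~R : A).

Definition is_multiplicative_set (C : comNzRingType) (M : set C) : Prop :=
  M 1 /\ forall x y, M x -> M y -> M (x * y).

(* The ring map [l : C -> S] identifies S with the ring of fractions C[1/M]:
   every element of S is a fraction c/m, and c/1 = 0 iff some m in M kills c. *)
Definition is_localization (C S : comNzRingType) (M : set C)
    (l : {rmorphism C -> S}) : Prop :=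
  [/\ forall m, M m -> exists y, l m * y = 1,
      forall s, exists c, exists2 m, M m & s * l m = l c
    & forall c, l c = 0 <-> exists2 m, M m & m * c = 0].

(* The ring map [q : C -> D] identifies D with the quotient C/I. *)
Definition is_quotient (C D : comNzRingType) (I : set C)
    (q : {rmorphism C -> D}) : Prop :=
  (forall d, exists c, q c = d) /\ (forall c, q c = 0 <-> I c).

Section Smoothness.
Variable A : comNzRingType.

(* Lifting along C -> C/J with J ^ 2 = 0.  The zero ring, which is not a
   [comAlgType], would only contribute trivial lifting problems: if C/J is zero
   then so is C. *)
Definition formally_smooth (S : comAlgType A) : Prop :=
  forall (C D : comAlgType A) (q : {lrmorphism C -> D}),
    (forall d, exists c, q c = d) ->
    (forall x y, q x = 0 -> q y = 0 -> x * y = 0) ->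
    forall g : {lrmorphism S -> D},
    exists h : {lrmorphism S -> C}, forall s, q (h s) = g s.

Definition finitely_generated_algebra (C : comAlgType A) : Prop :=
  exists s : seq C, forall B : {pred C},
    subalg_closed B -> {subset s <= B} -> forall x, x \in B.

Definition essentially_smooth (S : comAlgType A) : Prop :=
  [/\ injective (fun a : A => a%:A : S), formally_smooth S
    & exists C : comAlgType A, exists M : set C, exists l : {lrmorphism C -> S},
        [/\ finitely_generated_algebra C, is_multiplicative_set M
          & is_localization M l]].

(* [diff_op n d] : d belongs to D^n_{R|A}. *)
Fixpoint diff_op (R : comAlgType A) (n : nat) (d : R -> R) : Prop :=
  if n is n'.+1 then
    linear d /\ forall f : R, diff_op n' (fun x => d (f * x) - f * d x)
  else exists f : R, forall x, d x = f * x.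

End Smoothness.

Section SeparableExtensions.
Variables (k K : fieldType) (iota : {rmorphism k -> K}).

(* The subfield k(s) of K. *)
Definition adjoin (s : seq K) : set K :=
  [set x | forall F : {pred K}, divring_closed F ->
     (forall a, iota a \in F) -> {subset s <= F} -> x \in F].

Definition algebraically_independent (t : seq K) : Prop :=
  forall P : {mpoly k[size t]},
    mmap iota (fun i : 'I_(size t) => t`_i) P = 0 -> P = 0.

Definition separable_algebraic_over (F : set K) (x : K) : Prop :=
  exists P : {poly K}, [/\ forall i, F P`_i, root P x & separable_poly P].

(* Separability of a not necessarily algebraic extension K/k: every finitely
   generated subextension k(s) has a transcendence basis t over k such that
   k(s)/k(t) is separable algebraic. *)
Definition separable_extension : Prop :=
  forall s : seq K, exists t : seq K,
    [/\ forall x, x \in t -> adjoin s x,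
        algebraically_independent t
      & forall x, adjoin s x -> separable_algebraic_over (adjoin t) x].

End SeparableExtensions.

(* [loc : R -> RQ] is meant to be the localization of R at the prime Q. *)
Definition symbolic_power (R RQ : comNzRingType) (loc : {rmorphism R -> RQ})
    (Q : set R) (n : nat) : set R :=
  loc @^-1` (ideal_span (loc @` ideal_power Q n)).

Definition is_p_derivation (p : nat) (R : comNzRingType) (delta : R -> R) : Prop :=
  (forall x : R, p%:R * x = 0 -> x = 0) /\
  exists phi : {rmorphism R -> R}, forall x, phi x = x ^+ p + p%:R * delta x.

(* Only meaningful for n >= 1. *)
Definition mixed_power (A : comNzRingType) (R : comAlgType A) (delta : R -> R)
    (I : set R) (n : nat) : set R :=
  [set f | forall (s t : nat) (d : R -> R),
     (s + t <= n.-1)%N -> diff_op t d -> I (iter s delta (d f))].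

(* Main.v *)
Require Import Defs.
From HB Require Import structures.
From mathcomp Require Import all_boot all_order all_algebra all_field.
From mathcomp Require Import mpoly.
From mathcomp Require Import boolp classical_sets.
From mathcomp Require Import ring zify.

Set Implicit Arguments.
Unset Strict Implicit.
Unset Printing Implicit Defensive.

Import GRing.Theory.
Local Open Scope classical_set_scope.
Local Open Scope ring_scope.

(** The inclusion of the symbolic power in the mixed power is a filtration
    count: a differential operator of order t maps Q^(n) into Q^(n-t)
    ([diff_op_symb]), and since p lies in Q, delta maps Q^(n) into Q^(n-1)
    ([p_derivation_symb]).  Both hold for ordinary powers by induction and pass
    to symbolic powers by inverting elements outside Q.

    For the converse, let f be in the mixed power of level n+1.  By induction
    f lies in Q^(n), so a multiple of f by an element outside Q is a form of
    degree n in p and finitely many elements y_1, .., y_r of Q.  The variables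
    are removed one at a time ([mixed_sub_symb]).  If y = y_r is, up to a unit of
    R_Q and modulo the square of the maximal ideal, a combination of p and the
    other y_i, it can be dropped.  Otherwise there is an A-linear
    Hasse-Schmidt derivation (E_i) of R with E_1(y) outside Q and with E_1 of
    p and of the other y_i inside Q ([hasse_schmidt_exists]).  Write
    f = sum_i y^i g_i with g_i a form of degree n - i in the remaining
    generators.  If r is the largest index that occurs, E_r(f) is E_1(y)^r g_r
    up to an element of Q^(n-r+1) ([hasse_schmidt_expansion]); by induction
    E_r(f) lies in Q^(n-r+1), so y^r g_r lies in Q^(n+1) and can be discarded.
    Working down to r = 1 leaves a form in fewer generators, and in the end
    f = c p^n modulo Q^(n+1).  Then delta^n(f) is, modulo Q, an iterate of the
    Frobenius lift applied to c ([iter_p_derivation_unit]), so that c is in Q.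

    Formal smoothness and separability enter in the construction of (E_i).
    A derivation from R to the residue field K with prescribed values on y and
    the other generators comes from a coefficient subring G of R_Q: one that
    maps onto K and meets the maximal ideal inside N, an ideal maximal among
    those that contain p, the other generators and the square of the maximal
    ideal but not y.  Then R_Q = G + R_Q y + N, and the coefficient of y is the
    derivation.  G is a maximal subring above a lift of a polynomial ring on a
    separating transcendence basis of K, and maximality gives G -> K onto by
    one Newton step, which is exact because N contains the square of the
    maximal ideal ([coefficient_subring]).  As R is essentially of finite
    type, a multiple of the derivation by a nonzero element takes values in
    R/Q; it defines a ring map from R to R[t]/(Q t, t^2), and formal
    smoothness lifts it successively to R[t]/(t^m) ([hasse_schmidt_lift]). *)

(** * Quotient algebras and lifting along nilpotent extensions *)

Section IdealTheory.
Variable R : comNzRingType.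
Implicit Types (I J X : set R) (x y : R).

Lemma idealN I x : is_ideal I -> I x -> I (- x).
Proof. by case=> _ _ IM Ix; rewrite -mulN1r; apply: IM. Qed.

Lemma idealB I x y : is_ideal I -> I x -> I y -> I (x - y).
Proof. by move=> hI Ix Iy; have [_ ID _] := hI; apply: ID => //; apply: idealN. Qed.

Lemma idealMr I x y : is_ideal I -> I x -> I (x * y).
Proof. by case=> _ _ IM Ix; rewrite mulrC; apply: IM. Qed.

Lemma ideal_sum I (T : Type) (r : seq T) (P : pred T) (F : T -> R) :
  is_ideal I -> (forall i, P i -> I (F i)) -> I (\sum_(i <- r | P i) F i).
Proof. by case=> I0 ID _ IF; elim/big_ind: _. Qed.

Lemma ideal_subK I x y : is_ideal I -> I (x - y) -> I y -> I x.
Proof. by case=> _ ID _ Ixy Iy; rewrite -(subrK y x); apply: ID. Qed.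

End IdealTheory.

Section QuotientAlgebra.
Variables (A P : comNzRingType) (phi : {rmorphism A -> P}).
Variables (I : set P) (hI : is_ideal I) (I1 : ~ I 1).

(** The two proofs are arguments so that the ideal structure can be inferred
    from the term alone. *)
Definition ideal_pred of is_ideal I & ~ I 1 : P -> bool := fun x => `[< I x >].

Local Notation idP := (ideal_pred hI I1).

Fact ideal_pred_closed : idealr_closed idP.
Proof.
have [I0 ID IM] := hI.
split; rewrite /in_mem /=; [exact/asboolP | exact/asboolP |].
by move=> a x y /asboolP Ix /asboolP Iy; apply/asboolP; apply: ID => //; apply: IM.
Qed.

HB.instance Definition _ := isIdealr.Build P idP ideal_pred_closed.

Definition ideal_struct : idealr P := idP.

(** The structure map phi is an argument for the same reason: it determines the
    A-algebra structure. *)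
Definition quot_alg of {rmorphism A -> P} := {ideal_quot ideal_struct}.

Local Notation Qalg := (quot_alg phi).

HB.instance Definition _ := GRing.ComNzRing.on Qalg.

Definition quot_pi : P -> Qalg := \pi_({ideal_quot ideal_struct})%qT.

Fact quot_pi_zmod : zmod_morphism quot_pi.
Proof. exact: (rmorphB (\pi_({ideal_quot ideal_struct})%qT)). Qed.

Fact quot_pi_monoid : monoid_morphism quot_pi.
Proof.
by split; [exact: (rmorph1 (\pi_({ideal_quot ideal_struct})%qT))
         | exact: (rmorphM (\pi_({ideal_quot ideal_struct})%qT))].
Qed.

HB.instance Definition _ := GRing.isZmodMorphism.Build P Qalg quot_pi quot_pi_zmod.
HB.instance Definition _ := GRing.isMonoidMorphism.Build P Qalg quot_pi quot_pi_monoid.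

Lemma quot_pi_surj (d : Qalg) : exists c, quot_pi c = d.
Proof. by exists (repr d); rewrite /quot_pi reprK. Qed.

Lemma quot_pi_eq x y : quot_pi x = quot_pi y <-> I (x - y).
Proof.
split=> [exy|Ixy].
  by apply/asboolP; change (x - y \in (ideal_struct : pred P)); rewrite Quotient.idealrBE; apply/eqP.
by apply/eqP; rewrite -Quotient.idealrBE; apply/asboolP.
Qed.

Definition quot_scale (a : A) (x : Qalg) : Qalg := quot_pi (phi a) * x.

Fact quot_scaleA a b v : quot_scale a (quot_scale b v) = quot_scale (a * b) v.
Proof. by rewrite /quot_scale !rmorphM mulrA. Qed.
Fact quot_scale1 : left_id 1 quot_scale.
Proof. by move=> x; rewrite /quot_scale !rmorph1 mul1r. Qed.
Fact quot_scaleDr : right_distributive quot_scale +%R.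
Proof. by move=> a x y; rewrite /quot_scale mulrDr. Qed.
Fact quot_scaleDl v : {morph quot_scale^~ v : a b / a + b}.
Proof. by move=> a b; rewrite /quot_scale !rmorphD mulrDl. Qed.

HB.instance Definition _ := GRing.Zmodule_isLmodule.Build A Qalg
  quot_scaleA quot_scale1 quot_scaleDr quot_scaleDl.

Fact quot_scaleAl (a : A) (u v : Qalg) : a *: (u * v) = (a *: u) * v.
Proof. exact: mulrA. Qed.

HB.instance Definition _ := GRing.Lmodule_isLalgebra.Build A Qalg quot_scaleAl.
HB.instance Definition _ := GRing.Lalgebra_isComAlgebra.Build A Qalg.

Lemma quot_scaleE (a : A) (x : Qalg) : a *: x = quot_pi (phi a) * x.
Proof. by []. Qed.

End QuotientAlgebra.

Lemma lrmorphism_of (A : comNzRingType) (S D : comAlgType A) (f : S -> D) :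
    zmod_morphism f -> monoid_morphism f -> (forall a, f a%:A = a%:A) ->
  exists F : {lrmorphism S -> D}, F =1 f.
Proof.
move=> fB [f1 fM] fA.
have fZ : scalable f by move=> a x; rewrite -mulr_algl fM fA mulr_algl.
pose F : {lrmorphism S -> D} :=
  HB.pack f (GRing.isZmodMorphism.Build S D f fB)
    (GRing.isMonoidMorphism.Build S D f (conj f1 fM))
    (GRing.isScalable.Build A S D *:%R f fZ).
by exists F.
Qed.

(** A set-theoretic representative of an A-algebra map from R to P/I; it lets
    lifting problems be stated without quotient types. *)
Definition hom_mod (A : comNzRingType) (R : comAlgType A) (P : comNzRingType)
    (phi : A -> P) (I : set P) (e : R -> P) : Prop :=
  [/\ forall x y, I (e (x + y) - (e x + e y)),
      forall x y, I (e (x * y) - e x * e y)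
    & forall a, I (e a%:A - phi a)].

(** The definition of formal smoothness applied to P/I -> P/J, whose kernel has
    square zero since J^2 is contained in I. *)
Lemma lift_hom_mod (A : comNzRingType) (R : comAlgType A) (P : comNzRingType)
    (phi : {rmorphism A -> P}) (I J : set P) (e : R -> P) :
    formally_smooth R -> is_ideal I -> is_ideal J -> ~ J 1 -> I `<=` J ->
    (forall x y, J x -> J y -> I (x * y)) -> hom_mod phi J e ->
  exists e', hom_mod phi I e' /\ forall x, J (e' x - e x).
Proof.
move=> smR hI hJ J1 IJ JJ [eD eM eA].
have I1 : ~ I 1 by move=> /IJ.
pose C := quot_alg hI I1 phi; pose D := quot_alg hJ J1 phi.
pose pC : {rmorphism P -> C} := @quot_pi A P phi I hI I1.
pose pD : {rmorphism P -> D} := @quot_pi A P phi J hJ J1.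
have pCE x y : pC x = pC y <-> I (x - y) by apply: quot_pi_eq.
have pDE x y : pD x = pD y <-> J (x - y) by apply: quot_pi_eq.
have pCA a : (a%:A : C) = pC (phi a) by rewrite quot_scaleE mulr1.
have pDA a : (a%:A : D) = pD (phi a) by rewrite quot_scaleE mulr1.
have pCK (c : C) : {x | pC x = c} by apply: cid; apply: quot_pi_surj.
pose q (c : C) : D := pD (sval (pCK c)).
have qE x : q (pC x) = pD x.
  by apply/pDE/IJ/pCE; case: (pCK (pC x)).
have qB : zmod_morphism q.
  move=> c d; have [x <-] := pCK c; have [y <-] := pCK d.
  by rewrite -rmorphB !qE rmorphB.
have qM : monoid_morphism q.
  split; first by rewrite -(rmorph1 pC) qE rmorph1.
  move=> c d; have [x <-] := pCK c; have [y <-] := pCK d.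
  by rewrite -rmorphM !qE rmorphM.
have qA a : q a%:A = a%:A by rewrite pCA qE pDA.
have [Q QE] := lrmorphism_of qB qM qA.
have eD' x y : pD (e (x + y)) = pD (e x) + pD (e y) by rewrite -rmorphD; apply/pDE.
have gB : zmod_morphism (pD \o e).
  move=> x y /=; apply: (@addIr _ (pD (e y))); rewrite subrK -eD'.
  by rewrite subrK.
have gA a : (pD \o e) a%:A = a%:A by rewrite /= pDA; apply/pDE.
have gM : monoid_morphism (pD \o e).
  split; first by rewrite -[1]scale1r gA scale1r.
  by move=> x y /=; rewrite -rmorphM; apply/pDE.
have [g gE] := lrmorphism_of gB gM gA.
have [|| h hE] := smR C D Q _ _ g.
- move=> d; have [x <-] : exists x, pD x = d by apply: quot_pi_surj.
  by exists (pC x); rewrite QE qE.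
- move=> c d; have [x <-] := pCK c; have [y <-] := pCK d.
  rewrite !QE !qE => xJ yJ; rewrite -rmorphM -(rmorph0 pC); apply/pCE.
  rewrite subr0; apply: JJ.
    by rewrite -[x]subr0; apply/pDE; rewrite xJ rmorph0.
  by rewrite -[y]subr0; apply/pDE; rewrite yJ rmorph0.
pose e' x := sval (pCK (h x)).
have e'E x : pC (e' x) = h x by rewrite /e'; case: (pCK (h x)).
exists e'; split; last by move=> x; apply/pDE; rewrite -qE e'E -QE hE gE.
by split=> [x y|x y|a]; apply/pCE; rewrite ?(rmorphD, rmorphM) /= !e'E
  ?(rmorphD, rmorphM) //= -pCA rmorph_alg.
Qed.

(** * Differential operators and Hasse-Schmidt derivations *)

Section HasseSchmidt.
Variables (A : comNzRingType) (R : comAlgType A).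

(** The coefficients of an A-algebra map from R to R[t]/(t^(n+1)) that reduces to
    the identity modulo t. *)
Definition hasse_schmidt (n : nat) (E : nat -> R -> R) : Prop :=
  [/\ forall x, E 0 x = x,
      forall i x y, (i <= n)%N -> E i (x + y) = E i x + E i y,
      forall i x y, (i <= n)%N ->
        E i (x * y) = \sum_(j < i.+1) E j x * E (i - j)%N y
    & forall i a, (0 < i <= n)%N -> E i a%:A = 0].

(** The map x |-> x + e0(x) t is an algebra map to R[t]/(Q t, t^2).  The kernels
    of R[t]/(t^2) -> R[t]/(Q t, t^2) and R[t]/(t^(m+1)) -> R[t]/(t^m) have
    square zero, so it lifts step by step.  Dividing by Q t instead of t alone
    is what makes a derivation with values in R/Q sufficient. *)
Lemma hasse_schmidt_lift (Q : set R) (e0 : R -> R) (n : nat) :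
    formally_smooth R -> is_ideal Q -> ~ Q 1 ->
    (forall x y, Q (e0 (x + y) - (e0 x + e0 y))) ->
    (forall x y, Q (e0 (x * y) - (x * e0 y + e0 x * y))) ->
    (forall a, Q (e0 a%:A)) ->
  exists E, hasse_schmidt n.+1 E /\ forall x, Q (E 1 x - e0 x).
Proof.
move=> smR hQ Q1 e0D e0M e0A.
have [Q0 QD QM] := hQ.
pose phi : {rmorphism A -> {poly R}} := polyC \o in_alg R.
pose I m : set {poly R} := [set q | forall i, (i < m)%N -> q`_i = 0].
pose J : set {poly R} := [set q | q`_0 = 0 /\ Q q`_1].
have hI m : is_ideal (I m).
  split=> [i _|x y Ix Iy i im|a x Ix i im]; first by rewrite coef0.
    by rewrite coefD Ix ?Iy ?addr0.
  rewrite coefM big1 // => j _; rewrite Ix ?mulr0 //.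
  exact: leq_ltn_trans (leq_subr _ _) im.
have hJ : is_ideal J.
  split=> [|x y [x0 x1] [y0 y1]|a x [x0 x1]]; rewrite /J /= ?coef0 //.
    by rewrite !coefD x0 y0 addr0; split=> //; apply: QD.
  rewrite !coefM !big_ord_recl !big_ord0 /= x0 !mulr0 !addr0; split=> //.
  exact: QM.
pose f x : {poly R} := x%:P + e0 x *: 'X.
have f0 x : (f x)`_0 = x by rewrite coefD coefC coefZ coefX mulr0 addr0.
have f1 x : (f x)`_1 = e0 x by rewrite coefD coefC coefZ coefX mulr1 add0r.
clearbody f.
have hf : hom_mod phi J f.
  split=> [x y|x y|a]; split; rewrite !coefB ?coefD ?coefM ?f0 ?f1 ?subrr //.
  - by rewrite big_ord_recl big_ord0 /= !f0 addr0 subrr.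
  - by rewrite !big_ord_recl big_ord0 /= !f0 !f1 addr0.
  - by rewrite coefC /= subrr.
  - by rewrite coefC /= subr0.
have lift m : exists e, hom_mod phi (I m.+2) e /\ forall x, J (e x - f x).
  elim: m => [|m [e [he eJ]]].
    apply: (lift_hom_mod smR (hI _) hJ _ _ _ hf).
    - by case; rewrite coef1 => /eqP; rewrite oner_eq0.
    - by move=> q Iq; split; rewrite /= Iq.
    - move=> x y [x0 _] [y0 _] [|[|i]] // _.
        by rewrite coefM big_ord_recl big_ord0 /= x0 mul0r addr0.
      by rewrite coefM !big_ord_recl big_ord0 /= x0 y0 mul0r mulr0 !addr0.
  have [||| e' [he' e'I]] := lift_hom_mod smR (hI m.+3) (hI m.+2) _ _ _ he.
  - by move=> /(_ 0%N isT)/eqP; rewrite coef1 oner_eq0.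
  - by move=> q Iq i im; apply: Iq; apply: leqW.
  - move=> x y Ix Iy i im; rewrite coefM big1 // => j _.
    case: (ltnP j m.+2) => jm; first by rewrite Ix ?mul0r.
    by rewrite Iy ?mulr0 //; rewrite (leq_trans _ (ltn0Sn _)) // ltnS leqn0 subn_eq0;
      apply: leq_trans jm.
  exists e'; split=> // x; rewrite -(subrK (e x) (e' x)) -addrA.
  have [_ JD _] := hJ; apply: JD => //.
  by split; rewrite /= e'I.
have [e [[eD eM eA] eJ]] := lift n.
have eE x i : (i < n.+2)%N -> forall y, I n.+2 (e x - y) -> (e x)`_i = y`_i.
  by move=> im y /(_ i im) /eqP; rewrite coefB subr_eq0 => /eqP.
exists (fun i x => (e x)`_i); split; last first.
  by move=> x; have [_] := eJ x; rewrite coefB f1.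
split=> [x|i x y im|i x y im|i a /andP[i0 im]].
- by have [/eqP] := eJ x; rewrite coefB f0 subr_eq0 => /eqP.
- by rewrite (eE _ _ _ _ (eD x y)) ?coefD.
- by rewrite (eE _ _ _ _ (eM x y)) ?coefM.
- by rewrite (eE _ _ _ _ (eA a)) // coefC; case: i i0 {im}.
Qed.

Lemma diff_opD t (d d' : R -> R) :
  diff_op t d -> diff_op t d' -> diff_op t (fun x => d x + d' x).
Proof.
elim: t d d' => [|t IH] d d' /=.
  by move=> [f df] [g dg]; exists (f + g) => x; rewrite df dg mulrDl.
move=> [dL dC] [dL' dC']; split=> [a x y|f].
  by rewrite dL dL' scalerDr addrACA.
have := IH _ _ (dC f) (dC' f).
congr diff_op; apply: funext => x.
by rewrite mulrDr opprD addrACA.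
Qed.

Lemma diff_op_mulr t (d : R -> R) u :
  diff_op t d -> diff_op t (fun x => d (u * x)).
Proof.
elim: t d => [|t IH] d /=.
  by move=> [f df]; exists (f * u) => x; rewrite df mulrA.
move=> [dL dC]; split=> [a x y|f]; first by rewrite mulrDr -scalerAr dL.
have := IH _ (dC f).
by congr diff_op; apply: funext => x; rewrite mulrCA.
Qed.

Lemma diff_op_mull t (d : R -> R) u :
  diff_op t d -> diff_op t (fun x => u * d x).
Proof.
elim: t d => [|t IH] d /=.
  by move=> [f df]; exists (u * f) => x; rewrite df mulrA.
move=> [dL dC]; split=> [a x y|f]; first by rewrite dL mulrDr scalerAr.
have := IH _ (dC f).
by congr diff_op; apply: funext => x; rewrite mulrBr (mulrCA u f).
Qed.

Lemma diff_op_mul t u : diff_op t (fun x : R => u * x).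
Proof.
elim: t u => [|t IH] u /=; first by exists u.
split=> [a x y|f]; first by rewrite mulrDr scalerAr.
have := IH 0; congr diff_op; apply: funext => x.
by rewrite mulrCA subrr mul0r.
Qed.

Lemma diff_op_leq s t (d : R -> R) : (s <= t)%N -> diff_op s d -> diff_op t d.
Proof.
elim: t s d => [|t IH] [|s] d //.
  by move=> _ [f df]; rewrite (_ : d = *%R f); [exact: diff_op_mul | exact: funext].
by move=> st [dL dC]; split=> // f; apply: IH (dC f).
Qed.

Lemma diff_op_sum t (T : Type) (r : seq T) (F : T -> R -> R) :
  (forall i, diff_op t (F i)) -> diff_op t (fun x => \sum_(i <- r) F i x).
Proof.
move=> tF; elim: r => [|i r IH].
  have := diff_op_mul t 0; congr diff_op; apply: funext => x.
  by rewrite big_nil mul0r.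
have := diff_opD (tF i) IH; congr diff_op; apply: funext => x.
by rewrite big_cons.
Qed.

Lemma diff_op_comp s t (d d' : R -> R) :
  diff_op s d -> diff_op t d' -> diff_op (s + t) (fun x => d (d' x)).
Proof.
move: {2}(s + t)%N (erefl (s + t)%N) => m.
elim: m s t d d' => [|m IH] [|s] [|t] d d' //.
- by move=> _ [f df] [g dg]; exists (f * g) => x; rewrite df dg mulrA.
- move=> _ [f df] d't; rewrite (_ : (fun x => _) = (fun x => f * d' x)).
    exact: diff_op_mull.
  by apply: funext => x; rewrite df.
- move=> _ ds [g dg]; rewrite addn0 (_ : (fun x => _) = (fun x => d (g * x))).
    exact: diff_op_mulr.
  by apply: funext => x; rewrite dg.
move=> [stm] hd hd'; have [dL dC] := hd; have [dL' dC'] := hd'.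
split=> [a x y|f]; first by rewrite dL' dL.

have e1 := IH s.+1 t d _ _ hd (dC' f).
have e2 := IH s t.+1 _ d' stm (dC f) hd'.
rewrite addSnnS in e1; have := diff_opD (e1 stm) e2.
congr diff_op; apply: funext => x.
have dB u v : d (u - v) = d u - d v by rewrite -scaleN1r addrC dL scaleN1r addrC.
by rewrite dB addrA subrK.
Qed.

(** The commutator of E_i with f is the combination of E_0, .., E_(i-1) with
    coefficients E_i(f), .., E_1(f), so the order drops by one. *)
Lemma hasse_schmidt_diff_op n E i :
  hasse_schmidt n E -> (i <= n)%N -> diff_op i (E i).
Proof.
move=> [E0 ED EM EA]; elim/ltn_ind: i => -[|i] IH im.
  by exists 1 => x; rewrite E0 mul1r.
have Esmall j : (j <= i)%N -> diff_op i (E j).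
  by move=> ji; apply: diff_op_leq (ji) _; apply: IH => //; apply: leq_trans (leqW ji) _.
split=> [a x y|f].
  rewrite ED // -mulr_algl EM // big_ord_recl subn0 E0 mulr_algl big1 ?addr0 // => j _.
  by rewrite EA ?mul0r //= (leq_trans _ im) // ltn_ord.
rewrite (_ : (fun x => _) = fun x => \sum_(j < i.+1) E j.+1 f * E (i - j)%N x).
  by apply: diff_op_sum => j; apply/diff_op_mull/Esmall/leq_subr.
by apply: funext => x; rewrite EM // big_ord_recl subn0 E0 addrC addKr.
Qed.

End HasseSchmidt.

(** * Symbolic powers and differential operators *)

Section Powers.
Variable R : comNzRingType.
Implicit Types (I J Q X : set R) (x y : R) (m n : nat).

Lemma span_ideal X : is_ideal (ideal_span X).
Proof.
split=> [J [] //|x y Xx Xy J hJ XJ|a x Xx J hJ XJ]; have [_ JD JM] := hJ.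
  by apply: JD; [apply: Xx | apply: Xy].
by apply: JM; apply: Xx.
Qed.

Lemma span_sub X : X `<=` ideal_span X.
Proof. by move=> x Xx J _; apply. Qed.

Lemma span_min X I : is_ideal I -> X `<=` I -> ideal_span X `<=` I.
Proof. by move=> hI XI x; apply. Qed.

Lemma power_ideal I n : is_ideal (ideal_power I n).
Proof. exact: span_ideal. Qed.

Lemma power_prod I n (f : 'I_n -> R) :
  (forall i, I (f i)) -> ideal_power I n (\prod_(i < n) f i).
Proof. by move=> fI; apply: span_sub; exists f. Qed.

Lemma power0 I x : ideal_power I 0 x.
Proof.
have [_ _ IM] := power_ideal I 0; rewrite -[x]mulr1; apply: IM.
by have := @power_prod I 0 (fun=> 0); rewrite big_ord0; apply; case.
Qed.

Lemma powerM I m n x y :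
  ideal_power I m x -> ideal_power I n y -> ideal_power I (m + n) (x * y).
Proof.
move=> Ix Iy; have [I0 ID IM] := power_ideal I (m + n).
apply: (Ix [set x | ideal_power I (m + n) (x * y)]).
  split=> [|a b|a b]; rewrite /= ?mul0r // ?mulrDl; first exact: ID.
  by rewrite -mulrA; apply: IM.
move=> _ [f fI ->] /=.
apply: (Iy [set y | ideal_power I (m + n) (\prod_(i < m) f i * y)]).
  split=> [|a b|a b]; rewrite /= ?mulr0 // ?mulrDr; first exact: ID.
  by rewrite mulrCA; apply: IM.
move=> _ [g gI ->] /=.
pose h i := match fintype.split i with inl j => f j | inr k => g k end.
have hl j : h (lshift n j) = f j by rewrite /h -[lshift n j]/(unsplit (inl j)) unsplitK.
have hr j : h (rshift m j) = g j by rewrite /h -[rshift m j]/(unsplit (inr j)) unsplitK.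
have -> : \prod_(i < m) f i * \prod_(i < n) g i = \prod_(i < m + n) h i.
  by rewrite big_split_ord /=; congr (_ * _); apply: eq_bigr => i _; rewrite ?hl ?hr.
apply: power_prod => i.
by rewrite /h; case: fintype.split.
Qed.

Lemma power_leq I m n : (m <= n)%N -> ideal_power I n `<=` ideal_power I m.
Proof.
move=> /subnKC <-; apply: span_min; first exact: power_ideal.
move=> _ [f fI ->]; rewrite big_split_ord /=.
by apply: (idealMr _ (power_ideal I m)); apply: power_prod.
Qed.

Lemma power_mem I x : I x -> ideal_power I 1 x.
Proof.
by move=> Ix; have := @power_prod I 1 (fun=> x) (fun=> Ix); rewrite big_ord1.
Qed.

Lemma powerX I m n x : ideal_power I m x -> ideal_power I (n * m) (x ^+ n).
Proof.
move=> Ix; elim: n => [|n IH]; first exact: power0.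
by rewrite exprS mulSn; apply: powerM.
Qed.

(** The induction principle for powers of an ideal. *)
Lemma powerS_min I J n : is_ideal J ->
    (forall a b, I a -> ideal_power I n b -> J (a * b)) ->
  ideal_power I n.+1 `<=` J.
Proof.
move=> hJ IJ; apply: span_min => // _ [f fI ->].
by rewrite big_ord_recl; apply: IJ => //; apply: power_prod.
Qed.

Lemma power1 I x : is_ideal I -> ideal_power I 1 x -> I x.
Proof. by move=> hI; apply: powerS_min => // a b Ia _; apply: (idealMr _ hI). Qed.

Lemma power_sub I J n : I `<=` J -> ideal_power I n `<=` ideal_power J n.
Proof.
move=> IJ; apply: span_min; first exact: power_ideal.
by move=> _ [f fI ->]; apply: power_prod => i; apply/IJ/fI.
Qed.

Section SymbolicPowers.
Variables (Q : set R) (hQ : is_prime_ideal Q).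

Let QI : is_ideal Q. Proof. by case: hQ. Qed.
Let Q1 : ~ Q 1. Proof. by case: hQ. Qed.
Let QP x y : ~ Q x -> ~ Q y -> ~ Q (x * y).
Proof. by case: hQ => _ _ hM nx ny /hM []. Qed.

(** Membership in the symbolic power, with the denominator made explicit so that
    everything takes place in R. *)
Definition symb n : set R := [set x | exists2 u, ~ Q u & ideal_power Q n (u * x)].

Lemma symb_power n : ideal_power Q n `<=` symb n.
Proof. by move=> x Qx; exists 1; rewrite ?mul1r. Qed.

Lemma symb_ideal n : is_ideal (symb n).
Proof.
have [I0 ID IM] := power_ideal Q n.
split=> [|x y [u nu ux] [v nv vy]|a x [u nu ux]].
- exact: symb_power.
- exists (u * v); first exact: QP.
  by rewrite mulrDr; apply: ID; [rewrite -mulrA mulrCA | rewrite -mulrA]; apply: IM.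
- by exists u; rewrite // mulrCA; apply: IM.
Qed.

Lemma symb_leq m n : (m <= n)%N -> symb n `<=` symb m.
Proof. by move=> mn x [u nu ux]; exists u => //; apply: power_leq ux. Qed.

Lemma symbM m n x y : symb m x -> symb n y -> symb (m + n) (x * y).
Proof.
move=> [u nu ux] [v nv vy]; exists (u * v); first exact: QP.
by rewrite mulrACA; apply: powerM.
Qed.

Lemma symbK n u x : ~ Q u -> symb n (u * x) -> symb n x.
Proof.
by move=> nu [v nv vx]; exists (v * u); rewrite -?mulrA //; apply: QP.
Qed.

Lemma symb0 x : symb 0 x.
Proof. by apply: symb_power; apply: power0. Qed.

Lemma symb1 x : symb 1 x <-> Q x.
Proof.
split=> [[u nu /(power1 QI) ux]|Qx]; last by apply: symb_power; apply: power_mem.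
by apply: contrapT => nx; apply: (QP nu nx).
Qed.

End SymbolicPowers.
End Powers.

Arguments powerX {R I m} n {x}.

(** From d(ab) = a d(b) + [d,a](b), by induction on the order and on the
    exponent. *)
Lemma diff_op_power (A : comNzRingType) (R : comAlgType A) (Q : set R) t n d :
  diff_op t d -> forall x : R, ideal_power Q n x -> ideal_power Q (n - t) (d x).
Proof.
elim: t n d => [|t IHt] n d.
  by move=> [f df] x Qx; rewrite subn0 df; have [_ _ QM] := power_ideal Q n; apply: QM.
move=> hd; have [dL dC] := hd; elim: n => [|n IHn] x; first by move=> _; apply: power0.
have dD u v : d (u + v) = d u + d v by rewrite -[u in LHS]scale1r dL scale1r.
have dM a b : d (a * b) = a * d b + (d (a * b) - a * d b) by rewrite addrC subrK.
pose J := [set x | ideal_power Q n.+1 x /\ ideal_power Q (n.+1 - t.+1) (d x)].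
have hJ : is_ideal J.
  have [I0 ID IM] := power_ideal Q (n.+1 - t.+1).
  have [I0' ID' IM'] := power_ideal Q n.+1.
  split=> [|u v [Qu du] [Qv dv]|a u [Qu du]].
  - by split=> //; rewrite (_ : d 0 = 0) //; apply: (addrI (d 0)); rewrite -dD !addr0.
  - by split; [apply: ID' | rewrite dD; apply: ID].
  - split; first exact: IM'.
    rewrite dM; apply: ID; first exact: IM.
    apply: power_leq (IHt _ _ (dC a) _ Qu); rewrite subSS.
    exact/leq_sub2r/leqnSn.
suff: ideal_power Q n.+1 `<=` J by move=> sub /sub [].
apply: (powerS_min hJ) => a b Qa Qb; split.
  by rewrite -add1n; apply: powerM => //; apply: power_mem.
rewrite dM; have [_ ID _] := power_ideal Q (n.+1 - t.+1); apply: ID.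
  apply: power_leq (powerM (power_mem Qa) (IHn _ Qb)).
  by rewrite add1n leq_subLR addnS -addSn -leq_subLR subSS.
rewrite subSS; exact: (IHt _ _ (dC a) _ Qb).
Qed.

(** If u x is in Q^n then u d(x) = d(ux) - [d,u](x), and the commutator has
    smaller order. *)
Lemma diff_op_symb (A : comNzRingType) (R : comAlgType A) (Q : set R) t n d :
    is_prime_ideal Q -> diff_op t d ->
  forall x : R, symb Q n x -> symb Q (n - t) (d x).
Proof.
move=> hQ; elim: t d => [|t IH] d hd x.
  by case: hd => f df; rewrite df subn0; have [_ _ SM] := symb_ideal hQ n; apply: SM.
move=> [u nu ux]; have [dL dC] := hd.
apply: (symbK hQ nu); have -> : u * d x = d (u * x) - (d (u * x) - u * d x).
  by rewrite opprB addrC subrK.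
apply: (idealB (symb_ideal hQ _)); first by apply: symb_power => //; apply: diff_op_power hd _ ux.
have Sx : symb Q n x by exists u.
apply: symb_leq (IH _ (dC u) _ Sx); exact: leq_sub2l.
Qed.

(** * Action of a p-derivation on symbolic powers *)

Lemma exprD_prime (R : comNzRingType) (p : nat) (x y : R) :
  prime p -> exists z, (x + y) ^+ p = x ^+ p + y ^+ p + p%:R * (x * z).
Proof.
move=> pp; have p0 := prime_gt0 pp.
exists (\sum_(i < p.-1) (x ^+ (p.-1 - i.+1) * y ^+ i.+1) *+ ('C(p, i.+1) %/ p)).
rewrite exprDn -[p in LHS](prednK p0) big_ord_recl big_ord_recr /=.
rewrite /bump /= !add1n prednK // subn0 subnn bin0 binn !expr0 !mulr1n mulr1 mul1r.
rewrite [X in _ + X]addrC -addrA; congr (_ + (_ + _)).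
rewrite !mulr_sumr; apply: eq_bigr => i _; rewrite add1n.
have ip : (i.+1 < p)%N by rewrite -[p in (_ < p)%N](prednK p0) ltnS.
have eC : ('C(p, i.+1) = 'C(p, i.+1) %/ p * p)%N by rewrite divnK // prime_dvd_bin.
have -> : (p - i.+1 = (p.-1 - i.+1).+1)%N.
  by rewrite -subSn ?prednK // ltn_ord.
rewrite [in LHS]eC -mulr_natr natrM -[(_ * _) *+ _]mulr_natr exprS; ring.
Qed.

Section PDerivation.
Variables (p : nat) (pp : prime p) (R : comNzRingType) (delta : R -> R).
Hypothesis hdelta : is_p_derivation p delta.
Variables (Q : set R) (hQ : is_prime_ideal Q) (Qp : Q p%:R).

Let p_inj (x y : R) : p%:R * x = p%:R * y -> x = y.
Proof.
move=> /eqP; rewrite -subr_eq0 -mulrBr => /eqP.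
by case: hdelta => tf _ /tf /eqP; rewrite subr_eq0 => /eqP.
Qed.

Lemma p_derivation0 : delta 0 = 0.
Proof.
case: hdelta => _ [phi phiE]; apply: p_inj; rewrite mulr0.
by have := phiE 0; rewrite rmorph0 expr0n eqn0Ngt prime_gt0 // add0r => <-.
Qed.

(** The failure of additivity is a multiple of x by the divisibility of the
    binomial coefficients; only its membership in ideals matters. *)
Lemma p_derivationD x y : exists z, delta (x + y) = delta x + delta y - x * z.
Proof.
case: hdelta => _ [phi phiE]; have [z zE] := exprD_prime x y pp.
have e u : p%:R * delta u = phi u - u ^+ p by rewrite phiE addrC addKr.
by exists z; apply: p_inj; rewrite mulrBr mulrDr !e rmorphD zE; ring.
Qed.

Lemma p_derivationM x y :
  delta (x * y) = x ^+ p * delta y + y ^+ p * delta x + p%:R * (delta x * delta y).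
Proof.
case: hdelta => _ [phi phiE].
have e u : p%:R * delta u = phi u - u ^+ p by rewrite phiE addrC addKr.
apply: p_inj; rewrite e rmorphM !phiE exprMn; ring.
Qed.

(** In delta(ab) = a^p delta(b) + b^p delta(a) + p delta(a) delta(b), the last
    term is the one that needs p in Q. *)
Lemma p_derivation_power n x : ideal_power Q n x -> ideal_power Q n.-1 (delta x).
Proof.
have QI : is_ideal Q by case: hQ.
elim: n x => [|n IHn] x; first by move=> _; apply: power0.
pose J := [set x | ideal_power Q n.+1 x /\ ideal_power Q n (delta x)].
have [I0 ID IM] := power_ideal Q n.
have [I0' ID' IM'] := power_ideal Q n.+1.
have le_n := @power_leq _ Q n n.+1 (leqnSn n).
have IX u : ideal_power Q n.+1 u -> ideal_power Q n (u ^+ p).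
  move=> Qu; apply: (power_leq _ (powerX p Qu)).
  by rewrite (leq_trans (leqnSn n)) // leq_pmull ?prime_gt0.
have hJ : is_ideal J.
  split=> [|u v [Qu du] [Qv dv]|a u [Qu du]].
  - by split=> //; rewrite p_derivation0.
  - split; first exact: ID'.
    have [z ->] := p_derivationD u v.
    apply: (idealB (power_ideal _ _)); first exact: ID.
    by apply: (idealMr _ (power_ideal _ _)); apply: le_n.
  - split; first exact: IM'.
    rewrite p_derivationM; apply: (ID); last by rewrite mulrA; apply: IM.
    apply: (ID); first exact: IM.
    by apply: (idealMr _ (power_ideal _ _)); apply: IX.
suff: ideal_power Q n.+1 `<=` J by move=> sub /sub [].
apply: (powerS_min hJ) => a b Qa Qb.
have Qab : ideal_power Q n.+1 (a * b).
  by rewrite -add1n; apply: powerM => //; apply: power_mem.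
have Qpow m : (0 < m)%N -> forall c, Q c -> ideal_power Q m (c ^+ m).
  by move=> _ c Qc; rewrite -[m in ideal_power _ m]muln1; apply: powerX; apply: power_mem.
split=> //; rewrite p_derivationM; apply: (ID); [apply: (ID)|].
- apply: (power_leq _ (powerM (powerX p (power_mem Qa)) (IHn _ Qb))).
  by case: n {IHn Qb Qab le_n IX hJ J I0 ID IM I0' ID' IM'} => //= n;
    rewrite muln1 -add1n leq_add2r prime_gt0.
- apply: (idealMr _ (power_ideal _ _)); apply: (power_leq _ (powerX p Qb)).
  by rewrite leq_pmull ?prime_gt0.
- rewrite mulrCA; apply: IM.
  apply: (power_leq _ (powerM (power_mem Qp) (IHn _ Qb))).
  by rewrite add1n leqSpred.
Qed.

(** phi is the p-th power map modulo p, hence modulo Q. *)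
Lemma frobenius_lift_unit (phi : {rmorphism R -> R}) u :
  (forall x, phi x = x ^+ p + p%:R * delta x) -> ~ Q u -> ~ Q (phi u).
Proof.
move=> phiE nu; have [QI Q1 Qpr] := hQ; rewrite phiE => Qu; apply: nu.
have {}Qu : Q (u ^+ p).
  rewrite -[_ ^+ _](addrK (p%:R * delta u)); apply: (idealB QI) => //.
  exact: (idealMr _ QI).
by elim: {1}p Qu => [//|m IH]; rewrite exprS => /Qpr [].
Qed.

Lemma p_derivation_symb n x : symb Q n x -> symb Q n.-1 (delta x).
Proof.
case: hdelta => _ [phi phiE] [u nu ux].
have [QI _ Qpr] := hQ; have [_ QD QM] := QI.
have nphi := frobenius_lift_unit phiE nu.
apply: (symbK hQ nphi).
have -> : phi u * delta x = delta (u * x) - x ^+ p * delta u.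
  by rewrite p_derivationM phiE; ring.
apply: (idealB (symb_ideal hQ _)).
  by apply: (symb_power hQ); apply: p_derivation_power.
have Sx : symb Q n x by exists u.
apply: (idealMr _ (symb_ideal hQ _)).
rewrite -(prednK (prime_gt0 pp)) exprS; apply: (idealMr _ (symb_ideal hQ _)).
exact: symb_leq (leq_pred n) _ Sx.
Qed.

Lemma iter_p_derivation_symb s n x : symb Q n x -> symb Q (n - s) (iter s delta x).
Proof.
elim: s => [|s IH] Sx; first by rewrite subn0.
by rewrite iterS subnS; apply/p_derivation_symb/IH.
Qed.

(** With phi(x) = x^p + p delta(x), dividing phi(c p^(n+1)) = phi(c) p^(n+1) by p
    shows that delta(c p^(n+1)) is phi(c) p^n up to a term divisible by
    p^((n+1)p-1), which is negligible as (n+1)p - 1 >= n+1. *)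
Lemma iter_p_derivation_unit n c h :
  ~ Q c -> symb Q n.+1 h -> ~ Q (iter n delta (c * p%:R ^+ n + h)).
Proof.
have [QI _ Qpr] := hQ; have [_ QD QM] := QI.
elim: n c h => [|n IH] c h nc Sh.
  rewrite expr0 mulr1 /= => Qch; apply: nc; move/(symb1 hQ): Sh => Qh.
  by rewrite -[c](addrK h); apply: (idealB QI).
have [z E] := p_derivationD (c * p%:R ^+ n.+1) h.
case: hdelta => _ [phi phiE].
have nphi := frobenius_lift_unit phiE nc.
have np0 : (0 < n.+1 * p)%N by rewrite muln_gt0 (prime_gt0 pp).
have E' : delta (c * p%:R ^+ n.+1) = phi c * p%:R ^+ n - c ^+ p * p%:R ^+ (n.+1 * p).-1.
  have e u : p%:R * delta u = phi u - u ^+ p by rewrite phiE addrC addKr.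
  apply: p_inj; rewrite e rmorphM rmorphXn rmorph_nat exprMn -exprM.
  by rewrite mulrBr !(mulrCA p%:R) -!exprS (prednK np0).
rewrite iterSr E E' -!addrA; apply: IH => //.
have Sp m : symb Q m (p%:R ^+ m).
  by apply: (symb_power hQ); rewrite -[m in ideal_power _ m]muln1; apply: powerX; apply: power_mem.
have [_ SD SM] := symb_ideal hQ n.+1.
have SN u : symb Q n.+1 u -> symb Q n.+1 (- u) by apply: idealN; apply: symb_ideal.
apply: (SD); [apply/SN/SM | apply: (SD); [exact: p_derivation_symb Sh | apply/SN]].
  apply: (symb_leq _ (Sp _)); rewrite -ltnS (prednK np0).
  by rewrite (leq_trans _ (leq_mul (leqnn n.+1) (prime_gt1 pp))) // muln2 -addnn addSn ltnS leq_addl.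
by rewrite -mulrA mulrCA; apply: (idealMr _ (symb_ideal hQ _)).
Qed.

End PDerivation.

(** * Leading coefficients of Hasse-Schmidt derivations *)

Section GeneratedIdeals.
Variables (R : comNzRingType) (c : R).

(** The ideal generated by c and ys, in the form needed to peel off one generator
    at a time. *)
Fixpoint gen (ys : seq R) : set R :=
  if ys is y :: ys' then [set x | exists a, gen ys' (x - a * y)]
  else [set x | exists a, x = a * c].

Lemma gen_ideal ys : is_ideal (gen ys).
Proof.
elim: ys => [|y ys [I0 ID IM]] /=.
  split=> [|_ _ [a ->] [b ->]|a _ [b ->]].
  - by exists 0; rewrite mul0r.
  - by exists (a + b); rewrite mulrDl.
  - by exists (a * b); rewrite mulrA.
split=> [|x z [a xa] [b zb]|a x [b xb]].
- by exists 0; rewrite mul0r subr0.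
- by exists (a + b); rewrite mulrDl opprD addrACA; apply: ID.
- by exists (a * b); rewrite -mulrA -mulrBr; apply: IM.
Qed.

Lemma gen_cons y ys : gen ys `<=` gen (y :: ys).
Proof. by move=> x gx; exists 0; rewrite mul0r subr0. Qed.

Lemma gen_base ys : gen ys c.
Proof.
by elim: ys => [|y ys IH]; [exists 1; rewrite mul1r | apply: gen_cons].
Qed.

Lemma gen_mem ys y : y \in ys -> gen ys y.
Proof.
elim: ys => [//|z ys IH]; rewrite in_cons => /orP [/eqP ->|/IH gy].
  by exists 1; rewrite mul1r subrr; have [] := gen_ideal ys.
exact: gen_cons.
Qed.

Lemma gen_min (I : set R) ys :
  is_ideal I -> I c -> (forall y, y \in ys -> I y) -> gen ys `<=` I.
Proof.
move=> hI Ic; have [_ ID IM] := hI; elim: ys => [|y ys IH] ysI x /=.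
  by move=> [a ->]; apply: IM.
move=> [a gx]; rewrite -(subrK (a * y) x); apply: ID.
  by apply: IH gx => z zys; apply: ysI; rewrite in_cons zys orbT.
by apply: IM; apply: ysI; rewrite in_cons eqxx.
Qed.

(** A substitute for finite generation of Q: a single element of Q^n involves only
    finitely many elements of Q. *)
Lemma gen_power_exhaust (Q : set R) n x : is_ideal Q -> Q c ->
  ideal_power Q n x ->
  exists ys, (forall y, y \in ys -> Q y) /\ ideal_power (gen ys) n x.
Proof.
move=> hQ Qc; move: x; apply: span_min.
  split=> [|x y [ys [ysQ gx]] [zs [zsQ gy]]|a x [ys [ysQ gx]]].
  - by exists [::]; split=> //; have [] := power_ideal (gen [::]) n.
  - have sub (us : seq R) : (forall u, u \in us -> u \in ys ++ zs) ->
        gen us `<=` gen (ys ++ zs).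
      move=> h; apply: gen_min; [exact: gen_ideal | exact: gen_base |].
      by move=> u /h; apply: gen_mem.
    exists (ys ++ zs); split.
      by move=> u; rewrite mem_cat => /orP [/ysQ|/zsQ].
    have [_ ID _] := power_ideal (gen (ys ++ zs)) n.
    apply: ID.
      by apply: power_sub gx; apply: sub => u uys; rewrite mem_cat uys.
    by apply: power_sub gy; apply: sub => u uzs; rewrite mem_cat uzs orbT.
  - by exists ys; split=> //; have [_ _ IM] := power_ideal (gen ys) n; apply: IM.
move=> _ [f fQ ->]; exists (codom f); split; first by move=> _ /codomP [i ->].
by apply: power_prod => i; apply/gen_mem/codom_f.
Qed.

Lemma gen_nil_power n x : ideal_power (gen [::]) n x -> exists a, x = a * c ^+ n.
Proof.
elim: n x => [|n IH] x; first by exists x; rewrite expr0 mulr1.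
suff: ideal_power (gen [::]) n.+1 `<=` [set x | exists a, x = a * c ^+ n.+1] by apply.
apply: powerS_min.
  split=> [|_ _ [a ->] [b ->]|a _ [b ->]].
  - by exists 0; rewrite mul0r.
  - by exists (a + b); rewrite mulrDl.
  - by exists (a * b); rewrite mulrA.
by move=> _ b [a ->] /IH [a' ->]; exists (a * a'); rewrite mulrACA -exprS.
Qed.

Lemma gen_cons_power y ys n x : ideal_power (gen (y :: ys)) n x ->
  exists g : nat -> R, (forall i, (i <= n)%N -> ideal_power (gen ys) (n - i) (g i)) /\
    x = \sum_(i < n.+1) y ^+ i * g i.
Proof.
pose J := gen ys; pose T n := [set x | exists g : nat -> R,
  (forall i, (i <= n)%N -> ideal_power J (n - i) (g i)) /\
  x = \sum_(i < n.+1) y ^+ i * g i].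
have hJ m : is_ideal (ideal_power J m) by apply: power_ideal.
have hT m : is_ideal (T m).
  split=> [|_ _ [g [gJ ->]] [h [hhJ ->]]|a _ [g [gJ ->]]].
  - exists (fun=> 0); split=> [i _|]; first by have [] := hJ (m - i)%N.
    by rewrite big1 // => i _; rewrite mulr0.
  - exists (fun i => g i + h i); split=> [i im|].
      by have [_ ID _] := hJ (m - i)%N; apply: ID; [apply: gJ | apply: hhJ].
    by rewrite -big_split; apply: eq_bigr => i _; rewrite mulrDr.
  - exists (fun i => a * g i); split=> [i im|].
      by have [_ _ IM] := hJ (m - i)%N; apply: IM; apply: gJ.
    by rewrite mulr_sumr; apply: eq_bigr => i _; rewrite mulrCA.
elim: n x => [|n IH] x.
  move=> _; exists (fun=> x); split=> [i _|]; first exact: power0.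
  by rewrite big_ord1 expr0 mul1r.
suff: ideal_power (gen (y :: ys)) n.+1 `<=` T n.+1 by apply.
apply: (powerS_min (hT _)) => a b [alpha Ja] /IH [g [gJ ->]].
pose j := a - alpha * y.
exists (fun i => (if (i <= n)%N then j * g i else 0) +
                 (if i is i'.+1 then alpha * g i' else 0)); split=> [i im|].
  have [I0 ID IM] := hJ (n.+1 - i)%N; apply: ID.
    case: ifP => // ni; rewrite subSn // -add1n; apply: powerM; last exact: gJ.
    exact: power_mem.
  by case: i im I0 IM => [|i] im I0 IM //=; apply: IM; rewrite subSS; apply: gJ.
under [RHS]eq_bigr do rewrite mulrDr.
rewrite big_split /= [X in _ = X + _]big_ord_recr /= ltnn mulr0 addr0.
rewrite [X in _ = _ + X]big_ord_recl /= mulr0 add0r -big_split mulr_sumr.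
apply: eq_bigr => i _; rewrite -ltnS ltn_ord /= /bump /= add1n exprS /j; ring.
Qed.

End GeneratedIdeals.

Section LeadingCoefficients.
Variables (A : comNzRingType) (R : comAlgType A).
Variables (Q J : set R) (hQ : is_prime_ideal Q) (hJ : is_ideal J) (JQ : J `<=` Q).
Variables (m : nat) (E : nat -> R -> R).
Hypothesis hE : hasse_schmidt m E.
Hypothesis E1J : forall x, J x -> Q (E 1 x).

Let QI : is_ideal Q. Proof. by case: hQ. Qed.
Let EM i x y : (i <= m)%N -> E i (x * y) = \sum_(j < i.+1) E j x * E (i - j)%N y.
Proof. by case: hE => _ _ EM _; apply: EM. Qed.
Let E0 x : E 0 x = x. Proof. by case: hE. Qed.
Let ED i x y : (i <= m)%N -> E i (x + y) = E i x + E i y.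
Proof. by case: hE => _ ED _ _; apply: ED. Qed.

Lemma hasse_schmidt_power i n x :
  (i <= m)%N -> ideal_power Q n x -> ideal_power Q (n - i) (E i x).
Proof. by move=> im; apply: diff_op_power; apply: hasse_schmidt_diff_op hE im. Qed.

(** In general E_l only maps Q^n into Q^(n-l).  On powers of J one order is
    gained, because E_1 maps J into Q instead of R. *)
Lemma hasse_schmidt_flat_power l n x : (0 < l <= m)%N ->
  ideal_power J n x -> ideal_power Q (n.+1 - l) (E l x).
Proof.
elim: n l x => [|n IHn] l x.
  by case: l => // l _ _; rewrite subSS sub0n; apply: power0.
pose T := [set x | ideal_power J n.+1 x /\ forall l, (0 < l <= m)%N ->
   ideal_power Q (n.+2 - l) (E l x)].
have hT : is_ideal T.
  have [I0 ID IM] := power_ideal J n.+1.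
  split=> [|u v [Ju Eu] [Jv Ev]|a u [Ju Eu]].
  - split=> // i /andP [_ im].
    have -> : E i 0 = 0 by apply: (addrI (E i 0)); rewrite -ED // !addr0.
    by have [] := power_ideal Q (n.+2 - i).
  - split; first exact: ID.
    move=> i /[dup] i0m /andP [_ im]; rewrite ED //.
    by have [_ QD _] := power_ideal Q (n.+2 - i); apply: QD; [apply: Eu | apply: Ev].
  - split; first exact: IM.
    move=> i /[dup] i0m /andP [i0 im]; rewrite EM //.
    apply: ideal_sum => [|[j ji] _ /=]; first exact: power_ideal.
    have [_ _ QM] := power_ideal Q (n.+2 - i); apply: QM.
    have [->|ij] := posnP (i - j)%N.
      rewrite E0; apply: (power_leq _ (power_sub JQ Ju)).
      lia.
    apply: (power_leq _ (Eu _ _)); first by rewrite leq_sub2l // leq_subr.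
    by rewrite ij (leq_trans (leq_subr _ _) im).
suff sub : ideal_power J n.+1 `<=` T by move=> lm /sub [_]; apply.
apply: (powerS_min hT) => a b Ja Jb; split.
  by rewrite -add1n; apply: powerM => //; apply: power_mem.
move=> {}l /[dup] l0m /andP [l0 lm]; rewrite EM //.
apply: ideal_sum => [|[i il] _ /=]; first exact: power_ideal.
have [_ _ QM] := power_ideal Q (n.+2 - l).
case: (posnP i) => [->|i0].
  rewrite subn0 E0; apply: (power_leq _ (powerM (power_mem (JQ Ja)) (IHn _ _ l0m Jb))).
  lia.
case: (posnP (l - i)%N) => [li0|li]; last first.
  apply: (QM); apply: (power_leq _ (IHn _ _ _ Jb)); lia.
have {li0} eil : i = l by lia.
rewrite eil subnn E0; have Qb := power_sub JQ Jb.
case: (eqVneq l 1%N) => [->|l1].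
  rewrite subSS subn0 -add1n; apply: powerM Qb; apply: power_mem; exact: E1J.
by apply: (QM); apply: (power_leq _ Qb); lia.
Qed.

(** In R/Q[t] the series of y starts with E_1(y) t. *)
Lemma hasse_schmidt_leading r y : (r <= m)%N -> Q y ->
  Q (E r (y ^+ r) - E 1 y ^+ r).
Proof.
move=> + Qy; have [Q0 QD QM] := QI; elim: r => [|r IH] rm.
  by rewrite !expr0 E0 subrr.
rewrite exprS EM // 2!big_ord_recl /= E0 subn0 subSS subn0 /bump /= addn0.
have -> u v w : u + (E 1 y * v + w) - E 1 y ^+ r.+1 =
    u + (E 1 y * (v - E 1 y ^+ r) + w) by rewrite exprS; ring.
apply: (QD); first exact: (idealMr _ QI).
apply: (QD); first by apply: (QM); apply: IH; apply: ltnW.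
apply: ideal_sum => // -[i ir] _ /=; rewrite !add1n subSS; apply: (QM).
apply: (power1 QI).
apply: (power_leq _ (hasse_schmidt_power (n := r) _ _)); [lia | lia |].
by have := powerX r (power_mem Qy); rewrite muln1.
Qed.

(** The r-th coefficient of the product of the series of y^i and g_i has the terms
    E_j(y^i) E_(r-j)(g_i).  Those with j < r gain one order by
    [hasse_schmidt_flat_power]; those with j = r > i do since E_r(y^i) needs no
    order and g_i already has order n - i > n - r.  Only i = j = r is left. *)
Lemma hasse_schmidt_expansion n r y (g : nat -> R) : (r <= n)%N -> (n <= m)%N -> Q y ->
    (forall i, (i <= r)%N -> ideal_power J (n - i) (g i)) ->
  ideal_power Q (n.+1 - r)
    (E r (\sum_(i < r.+1) y ^+ i * g i) - E 1 y ^+ r * g r).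
Proof.
move=> rn nm Qy gJ; have rm := leq_trans rn nm.
have PI := power_ideal Q (n.+1 - r); have [P0 PD PM] := PI.
have Qyi i : ideal_power Q i (y ^+ i).
  by have := powerX i (power_mem Qy); rewrite muln1.
have Esum (F : nat -> R) k : E r (\sum_(i < k) F i) = \sum_(i < k) E r (F i).
  elim: k => [|k IH]; last by rewrite !big_ord_recr /= ED // IH.
  by rewrite !big_ord0; apply: (addrI (E r 0)); rewrite -ED // !addr0.
have mixed i j : (i <= r)%N -> (j < r)%N ->
    ideal_power Q (n.+1 - r) (E j (y ^+ i) * E (r - j)%N (g i)).
  move=> ir jr; apply: (power_leq _ (powerM (hasse_schmidt_power _ (Qyi i))
    (hasse_schmidt_flat_power _ (gJ i ir)))); lia.
rewrite (Esum (fun i => y ^+ i * g i)) big_ord_recr /= -addrA; apply: (PD).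
  apply: ideal_sum => // -[i ir] _ /=; rewrite EM // big_ord_recr /= subnn E0.
  apply: (PD); first by apply: ideal_sum => // -[j jr] _ /=; apply: mixed => //; apply: ltnW.
  apply: (PM); apply: (power_leq _ (power_sub JQ (gJ i (ltnW ir)))); lia.
rewrite EM // big_ord_recr /= subnn E0 -addrA; apply: (PD).
  by apply: ideal_sum => // -[j jr] _ /=; apply: mixed.
rewrite -mulrBl -[(n.+1 - r)%N](_ : 1 + (n - r) = _)%N; last by lia.
apply: powerM; last by apply: (power_sub JQ); apply: gJ.
by apply: power_mem; apply: hasse_schmidt_leading.
Qed.

End LeadingCoefficients.

(** * Coefficient subrings *)

(** Zorn's lemma above a given set, where only nonempty chains need an upper
    bound. *)
Lemma zorn_extend (T : Type) (P : set (set T)) (X0 : set T) :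
    P X0 ->
    (forall F : set (set T), F `<=` P -> total_on F subset -> F !=set0 ->
      P (\bigcup_(X in F) X)) ->
  exists A, [/\ X0 `<=` A, P A & forall B, A `<=` B -> P B -> B `<=` A].
Proof.
move=> PX0 PU.
have [F FP totF|A [PA maxA]] := @Zorn_bigcup T [set Y | P (Y `|` X0)].
  case: (eqVneq F set0) => [->|/set0P F0]; first by rewrite /= bigcup_set0 set0U.
  rewrite /=.
  have -> : \bigcup_(X in F) X `|` X0 = \bigcup_(X in [set Y `|` X0 | Y in F]) X.
    apply/seteqP; split=> [x [[Y FY Yx]|Xx]|x [_ [Y FY <-] [Yx|Xx]]].
    - by exists (Y `|` X0); [exists Y | left].
    - by have [Y FY] := F0; exists (Y `|` X0); [exists Y | right].
    - by left; exists Y.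
    - by right.
  apply: PU => [_ [Y FY <-]|_ _ [Y FY <-] [Z FZ <-]|]; first exact: FP.
    by case: (totF Y Z FY FZ) => YZ; [left|right]; apply: setSU.
  by have [Y FY] := F0; exists (Y `|` X0); exists Y.
exists (A `|` X0); split=> // B AB PB.
apply: contrapT => nBA; apply: (maxA B); last first.
  by rewrite /= (setUidl (subset_trans (@subsetUr _ A X0) AB)).
split; first exact: subset_trans (@subsetUl _ A X0) AB.
by move=> BA; apply: nBA; apply: (subset_trans BA); apply: subsetUl.
Qed.

Definition is_subring (S : comNzRingType) (G : set S) : Prop :=
  [/\ G 1, forall x y, G x -> G y -> G (x - y) & forall x y, G x -> G y -> G (x * y)].

Definition coefs_in (S : comNzRingType) (G : set S) (h : {poly S}) : Prop :=
  forall i, G h`_i.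

Section SubringPolynomials.
Variables (S : comNzRingType) (G : set S) (hG : is_subring G).

Lemma subring0 : G 0.
Proof. by have [G1 GB _] := hG; rewrite -(subrr 1); apply: GB. Qed.

Lemma subringD x y : G x -> G y -> G (x + y).
Proof.
have [G1 GB _] := hG; move=> Gx Gy; rewrite -[y]opprK; apply: (GB) => //.
by rewrite -sub0r; apply: GB => //; apply: subring0.
Qed.

Lemma coefs_in_subring : is_subring (coefs_in G).
Proof.
have [G1 GB GM] := hG; have G0 := subring0.
split=> [i|p q Gp Gq i|p q Gp Gq i].
- by rewrite coef1; case: eqP.
- by rewrite coefB; apply: GB.
- rewrite coefM; elim/big_ind: _ => [//|x y|j _]; first exact: subringD.
  exact: GM.
Qed.

Lemma coefs_inC c : G c -> coefs_in G c%:P.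
Proof. by move=> Gc i; rewrite coefC; case: eqP => // _; apply: subring0. Qed.

Lemma coefs_inX : coefs_in G 'X.
Proof. by have [G1 _ _] := hG => i; rewrite coefX; case: eqP => // _; apply: subring0. Qed.

(** Division by a monic polynomial without leaving the subring G. *)
Lemma coefs_in_divp (mu h : {poly S}) :
    mu \is monic -> coefs_in G mu -> coefs_in G h ->
  exists q r, [/\ coefs_in G q, coefs_in G r, h = q * mu + r
                & (size r < size mu)%N].
Proof.
move=> mon Gmu; have [P1 PB PM] := coefs_in_subring.
have m0 : (0 < size mu)%N by rewrite size_poly_gt0 monic_neq0.
elim: {h}(size h) {-2}h (leqnn (size h)) => [|n IH] h hn Gh.
  exists 0, h; split=> //; first by move=> i; rewrite coef0; apply: subring0.
    by rewrite mul0r add0r.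
  by rewrite (leq_ltn_trans hn).
case: (ltnP (size h) (size mu)) => hmu.
  exists 0, h; split=> //; first by move=> i; rewrite coef0; apply: subring0.
  by rewrite mul0r add0r.
pose k := (size h - size mu)%N; pose t := (lead_coef h)%:P * 'X^k.
have Gt : coefs_in G t.
  apply: PM; first by apply: coefs_inC; apply: Gh.
  by move=> i; rewrite coefXn; case: eqP => _; [case: hG | apply: subring0].
have Gh' : coefs_in G (h - t * mu) by apply: PB => //; apply: PM.
have sh' : (size (h - t * mu)%R <= n)%N.
  apply/leq_sizeP => j nj; rewrite coefB -mulrA coefCM coefXnM.
  have jh : ((size h).-1 <= j)%N by apply: leq_trans nj; case: (size h) hn.
  have kj : (k <= j)%N.
    apply: leq_trans jh; rewrite /k -(prednK m0) subnS -!subn1 leq_sub2r //.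
    exact: leq_subr.
  rewrite ltnNge kj /=.
  have [jE|jN] := eqVneq j (size h).-1.
    have -> : (j - k = (size mu).-1)%N.
      by rewrite jE /k -subn1 subnAC subKn // subn1.
    by rewrite jE -!lead_coefE (monicP mon) mulr1 subrr.
  have hj : (size h <= j)%N.
    have h0 : (0 < size h)%N := leq_trans m0 hmu.
    by rewrite -(prednK h0) ltn_neqAle eq_sym jN.
  rewrite nth_default // [mu`_(j - k)]nth_default ?mulr0 ?subr0 //.
  by rewrite leq_subRL // addnC subnKC.
have [q [r [Gq Gr E sr]]] := IH _ sh' Gh'.
exists (q + t), r; split=> //.
  by move=> i; rewrite coefD; apply: subringD.
by rewrite mulrDl addrAC -E subrK.
Qed.

End SubringPolynomials.

Lemma horner_taylor2 (S : comNzRingType) (f : {poly S}) (x e : S) :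
  exists c, f.[x + e] = f.[x] + f^`().[x] * e + c * (e * e).
Proof.
elim/poly_ind: f => [|f a [c E]]; first by exists 0; rewrite deriv0 !horner0 !mul0r !addr0.
exists (c * (x + e) + f^`().[x]).
rewrite derivD derivM derivX derivC !(hornerD, hornerM, hornerX, hornerC) E.
ring.
Qed.

Section CoefficientSubring.
Variables (S : comNzRingType) (K : fieldType) (res : {rmorphism S -> K}).
Hypothesis res_surj : forall kappa, exists s, res s = kappa.
Hypothesis res_unit : forall s, res s != 0 -> exists y, s * y = 1.
Variables (N : set S) (hN : is_ideal N).
Hypothesis N_sqr : forall x y, res x = 0 -> res y = 0 -> N (x * y).

(** The image of such a subring in S/N meets the maximal ideal only in 0. *)
Definition coefficient_like (G : set S) : Prop :=
  is_subring G /\ forall g, G g -> res g = 0 -> N g.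

(** Let G be maximal above G0.  Adjoining inverses of units keeps the property, so
    the image F of G in K is a field.  For theta in K, let mu be its minimal
    polynomial over F and M a monic lift of mu to G[X].  As mu'(theta) is
    nonzero, one Newton step gives a lift t of theta with M(t) in N.  Division by
    M shows that an element of G[t] in the maximal ideal is in N, so G[t] = G
    and theta is in F. *)
Lemma coefficient_subring (G0 : set S) :
    coefficient_like G0 ->
    (forall kappa, separable_algebraic_over
       [set x | forall F : {pred K}, divring_closed F ->
                  (forall g, G0 g -> res g \in F) -> x \in F] kappa) ->
  exists G, [/\ G0 `<=` G, coefficient_like G
    & forall kappa, exists2 g, G g & res g = kappa].
Proof.
move=> hG0 sepK.
have [||G [G0G hG maxG]] := @zorn_extend S [set G | coefficient_like G] G0 => //.
  move=> F FP totF [X0 FX0].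
  have FU x y : (\bigcup_(X in F) X) x -> (\bigcup_(X in F) X) y ->
      exists X, [/\ F X, X x & X y].
    move=> [X FX Xx] [Y FY Yy].
    by case: (totF X Y FX FY) => XY; [exists Y | exists X]; split=> //; apply: XY.
  split; last by move=> g [X /FP [_ h] Xg]; apply: h.
  split.
  - by exists X0 => //; have [[]] := FP _ FX0.
  - move=> x y /FU h /h [X [FX Xx Xy]]; exists X => //.
    by have [[_ XB _] _] := FP _ FX; apply: XB.
  - move=> x y /FU h /h [X [FX Xx Xy]]; exists X => //.
    by have [[_ _ XM] _] := FP _ FX; apply: XM.
have [sG GN] := hG; have [G1 GB GM] := sG.
exists G; split=> // theta.
have Ginv g : G g -> res g != 0 -> exists2 y, G y & g * y = 1.
  move=> Gg g0; have [y gy] := res_unit g0.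
  pose G' := [set s | exists n, G (s * g ^+ n)].
  have Gpow n : G (g ^+ n) by elim: n => [|n IH]; rewrite ?expr0 // exprS; apply: GM.
  have up s n m : G (s * g ^+ n) -> G (s * g ^+ (n + m)).
    by move=> Gs; rewrite exprD mulrA; apply: GM.
  suff : G' `<=` G.
    move=> sub; exists y => //; apply: sub; exists 1%N; rewrite expr1 mulrC gy; exact: G1.
  apply: maxG; first by move=> s Gs; exists 0%N; rewrite expr0 mulr1.
  split; first split.
  - by exists 0%N; rewrite mulr1.
  - move=> s t [n Gs] [m Gt]; exists (n + m)%N; rewrite mulrBl; apply: GB; first exact: up.
    by rewrite addnC; apply: up.
  - by move=> s t [n Gs] [m Gt]; exists (n + m)%N; rewrite exprD mulrACA; apply: GM.
  move=> s [n Gs] s0.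
  have /(GN _ Gs) Ns : res (s * g ^+ n) = 0 by rewrite rmorphM s0 mul0r.
  have -> : s = y ^+ n * (s * g ^+ n).
    by rewrite mulrCA -exprMn (mulrC y) gy expr1n mulr1.
  by have [_ _ NM] := hN; apply: NM.
pose F : {pred K} := fun x => `[< exists2 g, G g & res g = x >].
have FP x : reflect (exists2 g, G g & res g = x) (x \in F) by apply: asboolP.
have FinG g : G g -> res g \in F by move=> Gg; apply/FP; exists g.
have FB : {in F &, forall x y, x - y \in F}.
  move=> x y.
  by move=> /FP [g Gg <-] /FP [h Gh <-]; rewrite -rmorphB; apply/FinG/GB.
have FV x : x \in F -> x^-1 \in F.
  move=> /FP [g Gg <-]; have [->|g0] := eqVneq (res g) 0.
    by rewrite invr0; have := FinG _ (subring0 sG); rewrite rmorph0.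
  have [y Gy gy] := Ginv g Gg g0; suff -> : (res g)^-1 = res y by apply: FinG.
  by apply: (mulfI g0); rewrite divff // -rmorphM gy rmorph1.
have FM x y : x \in F -> y \in F -> x * y \in F.
  by move=> /FP [g Gg <-] /FP [h Gh <-]; rewrite -rmorphM; apply/FinG/GM.
have F1 : 1 \in F by rewrite -(rmorph1 res); apply: FinG.
have Fdiv : divring_closed F.
  by split=> // x y Fx Fy; apply: FM => //; apply: FV.
(* A lift from F to G that sends 1 to 1, so that monic polynomials lift to
   monic polynomials. *)
have [lift liftP] : exists lift : K -> S, forall x,
    (x \in F -> G (lift x) /\ res (lift x) = x) /\ (x = 1 -> lift x = 1).
  suff /choice [f fP] : forall x, exists s,
      (x \in F -> G s /\ res s = x) /\ (x = 1 -> s = 1) by exists f.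
  move=> x; have [->|x1] := eqVneq x 1; first by exists 1; rewrite rmorph1.
  case: (boolP (x \in F)) => [/FP [g Gg gx]|_].
    by exists g; split=> // x1'; rewrite x1' eqxx in x1.
  by exists 0; split=> // x1'; rewrite x1' eqxx in x1.
pose liftp (f : {poly K}) := \poly_(i < size f) lift f`_i.
have liftpG (f : {poly K}) : (forall i, f`_i \in F) -> coefs_in G (liftp f).
  move=> Ff i; rewrite coef_poly; case: ifP => _; last exact: subring0.
  by have [/(_ (Ff i)) []] := liftP f`_i.
have liftpK (f : {poly K}) : (forall i, f`_i \in F) -> map_poly res (liftp f) = f.
  move=> Ff; apply/polyP => i; rewrite coef_map /= coef_poly.
  case: ltnP => fi; last by rewrite rmorph0 nth_default.
  by have [/(_ (Ff i)) []] := liftP f`_i.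
have [P [PF Proot Psep]] := sepK theta.
have {}PF i : P`_i \in F by apply: PF => // g Gg; apply/FinG/G0G.
have P0 := separable_poly_neq0 Psep.
rewrite unlock in Psep.
(* mu0 has minimal size among the nonzero polynomials over F that vanish at theta *)
pose ann m := `[< exists f : {poly K}, [/\ forall i, f`_i \in F, f != 0, root f theta & size f = m] >].
have exm : exists m, ann m by exists (size P); apply/asboolP; exists P.
have [m /asboolP [mu0 [mu0F mu00 mu0root mu0size]] mmin] := ex_minnP exm.
pose mu := (lead_coef mu0)^-1 *: mu0.
have lc0 : lead_coef mu0 != 0 by rewrite lead_coef_eq0.
have muF i : mu`_i \in F by rewrite coefZ; apply: FM => //; apply: FV; apply: mu0F.
have mumon : mu \is monic by rewrite monicE lead_coefZ mulVf.
have muroot : root mu theta by rewrite rootZ ?invr_eq0.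
have musize : size mu = m by rewrite size_scale ?invr_eq0.
have small (r : {poly K}) : (forall i, r`_i \in F) -> root r theta -> (size r < m)%N -> r = 0.
  move=> rF rr; rewrite ltnNge => /negP nsr; apply/eqP; apply: contrapT => /negP r0.
  by apply/nsr/mmin/asboolP; exists r.
pose M := liftp mu.
have Mi i : M`_i = if (i < size mu)%N then lift mu`_i else 0 by rewrite coef_poly.
have m0 : (0 < size mu)%N by rewrite size_poly_gt0 monic_neq0.
have sizeM : size M = size mu.
  apply: size_poly_eq; rewrite -lead_coefE (monicP mumon).
  by have [_ ->] := liftP 1; rewrite ?oner_eq0.
have Mmon : M \is monic.
  rewrite monicE lead_coefE sizeM Mi prednK // leqnn -lead_coefE (monicP mumon).
  by have [_ ->] := liftP 1.
have MG : coefs_in G M by apply: liftpG.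
have MK : map_poly res M = mu by apply: liftpK.
have divM (h : {poly S}) : coefs_in G h -> root (map_poly res h) theta ->
    exists q r, [/\ coefs_in G r, h = q * M + r & map_poly res r = 0].
  move=> Gh rh; have [q [r [_ Gr hE sr]]] := coefs_in_divp sG Mmon MG Gh.
  exists q, r; split=> //; apply: small.
  - by move=> i; rewrite coef_map; apply: FinG.
  - move: rh; rewrite hE rmorphD rmorphM /= MK !rootE hornerD hornerM.
    by rewrite (rootP muroot) mulr0 add0r.
  - by rewrite -musize -sizeM; apply: leq_ltn_trans sr; apply: size_map_poly_leq || exact: size_poly.
(* mu divides the separable polynomial P, so theta is a simple root of mu *)
have dmu : (mu^`()).[theta] != 0.
  have [||q [r [_ PE r0]]] := divM (liftp P); rewrite ?liftpK //; first exact: liftpG.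
  have {}PE : P = map_poly res q * mu by rewrite -[LHS]liftpK // PE rmorphD rmorphM /= r0 MK addr0.
  have := coprimep_root Psep Proot; rewrite PE derivM hornerD !hornerM (rootP muroot).
  by rewrite mulr0 add0r mulf_eq0 negb_or => /andP [].
have [theta0 theta0E] := res_surj theta.
have resh (h : {poly S}) : res h.[theta0] = (map_poly res h).[theta] by rewrite -theta0E horner_map.
have [y dy] : exists y, M^`().[theta0] * y = 1.
  by apply: res_unit; rewrite resh -deriv_map MK.
pose e := - (M.[theta0] * y).
have rese : res e = 0.
  by rewrite rmorphN rmorphM resh MK (rootP muroot) mul0r oppr0.
pose t := theta0 + e.
have rest : res t = theta by rewrite rmorphD rese addr0.
have NMt : N M.[t].
  have [c ->] := horner_taylor2 M theta0 e.
  have -> : M.[theta0] + M^`().[theta0] * e = 0.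
    by rewrite /e mulrN mulrCA dy mulr1 subrr.
  by rewrite add0r; have [_ _ NM] := hN; apply: NM; apply: N_sqr.
pose G' := [set s | exists2 h, coefs_in G h & s = h.[t]].
suff /(_ t) Gt : G' `<=` G.
  exists t => //; apply: Gt; exists 'X; [exact: coefs_inX | by rewrite hornerX].
have [P1 PB PM] := coefs_in_subring sG.
apply: maxG; first by move=> s Gs; exists s%:P; [exact: coefs_inC | rewrite hornerC].
split; first split.
- by exists 1 => //; rewrite hornerC.
- by move=> _ _ [f Gf ->] [g Gg ->]; exists (f - g); [apply: PB | rewrite !hornerE].
- by move=> _ _ [f Gf ->] [g Gg ->]; exists (f * g); [apply: PM | rewrite hornerM].
move=> _ [h Gh ->] rh0.
have [|q [r [Gr -> r0]]] := divM h Gh; first by rewrite rootE -rest horner_map rh0.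
have [_ ND NM] := hN; rewrite hornerD hornerM; apply: (ND); first exact: NM.
rewrite horner_coef; apply: ideal_sum => // i _; apply: (idealMr _ hN).
by apply: GN => //; rewrite -coef_map r0 coef0.
Qed.

End CoefficientSubring.

(** * Derivations into the residue field *)

Section Localization.
Variables (R S : comNzRingType) (Q : set R) (hQ : is_prime_ideal Q).
Variables (loc : {rmorphism R -> S}) (hloc : is_localization (~` Q) loc).

Let Q1 : ~ Q 1. Proof. by case: hQ. Qed.
Let QP x y : ~ Q x -> ~ Q y -> ~ Q (x * y).
Proof. by case: hQ => _ _ hM nx ny /hM []. Qed.

(** The extension of I to the localization, with explicit denominators. *)
Definition extended (I : set R) : set S :=
  [set s | exists u x, [/\ ~ Q u, I x & s * loc u = loc x]].

Lemma loc_frac s : exists u x, ~ Q u /\ s * loc u = loc x.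
Proof. by have [_ /(_ s) [x [u nu E]] _] := hloc; exists u, x. Qed.

Lemma extended_ideal I : is_ideal I -> is_ideal (extended I).
Proof.
move=> [I0 ID IM]; split=> [|s t [u [x [nu Ix E]]] [v [y [nv Iy F]]]|s t [u [x [nu Ix E]]]].
- by exists 1, 0; split=> //; rewrite mul0r rmorph0.
- exists (u * v), (x * v + y * u); split; first exact: QP.
    by apply: ID; rewrite mulrC; apply: IM.
  rewrite rmorphD !rmorphM mulrDl -E -F; ring.
- have [v [y [nv F]]] := loc_frac s.
  exists (v * u), (y * x); split; [exact: QP | exact: IM |].
  by rewrite !rmorphM -F -E mulrACA.
Qed.

Lemma extended_mem (I : set R) x : I x -> extended I (loc x).
Proof. by move=> Ix; exists 1, x; rewrite rmorph1 mulr1. Qed.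

Lemma ideal_span_loc I : is_ideal I -> ideal_span (loc @` I) = extended I.
Proof.
move=> hI; apply/seteqP; split.
  apply: span_min; first exact: extended_ideal.
  by move=> _ [x Ix <-]; apply: extended_mem.
move=> s [u [x [nu Ix E]]] L hL IL.
have [/(_ u nu) [y uy] _ _] := hloc.
have -> : s = y * loc x by rewrite -E mulrCA (mulrC y) uy mulr1.
by have [_ _ LM] := hL; apply: LM; apply: IL; exists x.
Qed.

Lemma extended_loc I x : is_ideal I ->
  extended I (loc x) <-> exists2 u, ~ Q u & I (u * x).
Proof.
move=> [I0 ID IM]; split=> [[u [y [nu Iy E]]]|[u nu Iux]]; last first.
  by exists u, (u * x); split=> //; rewrite rmorphM mulrC.
have [_ _ /(_ (x * u - y)) [ker _]] := hloc.
have [|w nw /eqP wE] := ker; first by rewrite rmorphB rmorphM E subrr.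
exists (w * u); first exact: QP.
move: wE; rewrite mulrBr subr_eq0 => /eqP wE.
by rewrite -mulrA (mulrC u) wE; apply: IM.
Qed.

Lemma symbolic_powerE n : symbolic_power loc Q n = symb Q n.
Proof.
rewrite /symbolic_power ideal_span_loc; last exact: power_ideal.
by apply/seteqP; split=> x; rewrite /preimage /= => /(extended_loc _ (power_ideal Q n)).
Qed.

Variables (K : fieldType) (resQ : {rmorphism S -> K}).
Hypothesis hK : is_quotient (ideal_span (loc @` Q)) resQ.

Let QI : is_ideal Q. Proof. by case: hQ. Qed.

Lemma residue0 s : resQ s = 0 <-> extended Q s.
Proof. by case: hK => _ /(_ s); rewrite ideal_span_loc. Qed.

Lemma residue_loc0 x : resQ (loc x) = 0 <-> Q x.
Proof.
rewrite residue0 extended_loc //; split=> [[u nu Qux]|Qx].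
  by apply: contrapT => nx; apply: (QP nu nx).
by exists 1; rewrite ?mul1r.
Qed.

Lemma residue_unit s : resQ s != 0 -> exists y, s * y = 1.
Proof.
move=> /eqP s0; have [u [x [nu E]]] := loc_frac s.
have [locU _ _] := hloc.
have [|y xy] := locU x; last by exists (loc u * y); rewrite mulrA E.
by move=> Qx; apply/s0/residue0; exists u, x.
Qed.

Lemma residue_surj kappa : exists s, resQ s = kappa.
Proof. by case: hK. Qed.

Lemma residue_frac kappa : exists u x, ~ Q u /\ kappa * resQ (loc u) = resQ (loc x).
Proof.
have [s <-] := residue_surj kappa; have [u [x [nu E]]] := loc_frac s.
by exists u, x; rewrite -rmorphM E.
Qed.

End Localization.

Section ResidueDerivations.
Variables (p : nat) (A : comNzRingType) (R : comAlgType A).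
Variables (S : comNzRingType) (Q : set R) (hQ : is_prime_ideal Q).
Variables (loc : {rmorphism R -> S}) (hloc : is_localization (~` Q) loc).
Variables (K : fieldType) (resQ : {rmorphism S -> K}).
Hypothesis hK : is_quotient (ideal_span (loc @` Q)) resQ.
Variables (k : fieldType) (resA : {rmorphism A -> k}).
Hypothesis hk : is_quotient (principal (p%:R : A)) resA.
Variables (iota : {rmorphism k -> K}).
Hypothesis hiota : forall a : A, iota (resA a) = resQ (loc (a%:A : R)).
Hypothesis hsep : separable_extension iota.
Hypothesis Rfin : exists C : comAlgType A, exists M : set C, exists l : {lrmorphism C -> R},
        [/\ finitely_generated_algebra C, is_multiplicative_set M
          & is_localization M l].

Let rho : {rmorphism R -> K} := resQ \o loc.
Let rho0 x : rho x = 0 <-> Q x. Proof. exact: (residue_loc0 hQ hloc hK). Qed.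
Let rhoA a : rho a%:A = iota (resA a). Proof. by rewrite hiota. Qed.
Let QI : is_ideal Q. Proof. by case: hQ. Qed.
Let QP x y : ~ Q x -> ~ Q y -> ~ Q (x * y).
Proof. by case: hQ => _ _ hM nx ny /hM []. Qed.

Definition residue_derivation (D : R -> K) : Prop :=
  [/\ forall x y, D (x + y) = D x + D y,
      forall x y, D (x * y) = rho x * D y + D x * rho y
    & forall a, D a%:A = 0].

(** Separability provides a transcendence basis for each finitely generated
    subextension; with this lemma one basis serves all of K. *)
Lemma residue_field_fg : exists s : seq K, forall x, adjoin iota s x.
Proof.
have [C [M [l [[gs gsP] _ [lU lS _]]]]] := Rfin.
exists [seq rho (l c) | c <- gs] => x F Fdiv Fk Fs.
have [F1 FB FV] := Fdiv.
have F0 : 0 \in F by rewrite -(subrr 1); apply: FB.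
have FD : {in F &, forall x y, x + y \in F}.
  by move=> u v Fu Fv; rewrite -[v]opprK; apply: (FB) => //; rewrite -sub0r; apply: FB.
have FM : {in F &, forall x y, x * y \in F}.
  move=> u v Fu Fv; rewrite -[v]invrK; apply: (FV) => //.
  by rewrite -[v^-1]mul1r; apply: FV.
have FC c : rho (l c) \in F.
  pose B : {pred C} := [pred c | rho (l c) \in F].
  apply: (gsP B); last by move=> d ds; apply: Fs; apply: map_f.
  have Bin u : (u \in B) = (rho (l u) \in F) by [].
  split=> [|a u v|u v]; rewrite !Bin.
  - by rewrite (rmorph1 l) (rmorph1 rho).
  - move=> Fu Fv; rewrite linearP (rmorphD rho) -mulr_algl (rmorphM rho) rhoA.
    by apply: (FD) => //; apply: FM.
  - by move=> Fu Fv; rewrite (rmorphM l) (rmorphM rho); apply: FM.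
have FR r : rho r \in F.
  have [c [m Mm E]] := lS r; have [y my] := lU m Mm.
  have rm0 : rho (l m) != 0.
    apply/eqP => m0; have := oner_neq0 K.
    by rewrite -(rmorph1 rho) -my rmorphM m0 mul0r eqxx.
  have -> : rho r = rho (l c) / rho (l m) by rewrite -E rmorphM mulfK.
  exact: FV.
have [u [y [nu E]]] := residue_frac hloc hK x.
have u0 : rho u != 0 by apply/eqP => /rho0.
have -> : x = rho y / rho u by rewrite -[rho y]E mulfK.
exact: FV.
Qed.

(** Polynomial expressions over A in lifts of a separating transcendence basis.  If
    such an expression lies in the maximal ideal, algebraic independence forces
    its coefficients into pA, hence its value into N. *)
Lemma transcendental_coefficients (N : set S) : is_ideal N -> N p%:R ->
  exists G0, [/\ coefficient_like resQ N G0, forall a, G0 (loc a%:A)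
    & forall kappa, separable_algebraic_over
       [set x | forall F : {pred K}, divring_closed F ->
                  (forall g, G0 g -> resQ g \in F) -> x \in F] kappa].
Proof.
move=> hN Np; have [s sK] := residue_field_fg.
have [t [_ talg tsep]] := hsep s.
have [T TE] : exists T : 'I_(size t) -> S, forall i, resQ (T i) = t`_i.
  suff /choice [f fP] : forall i : 'I_(size t), exists s, resQ s = t`_i by exists f.
  by move=> i; apply: (residue_surj hK).
pose f : {rmorphism A -> S} := loc \o in_alg R.
have rf a : resQ (f a) = iota (resA a) by rewrite hiota.
pose ev : {rmorphism {mpoly A[size t]} -> S} := mmap f T.
have resev q : resQ (ev q) = mmap iota (fun i => t`_i) (map_mpoly resA q).
  rewrite /ev /map_mpoly {1 3}/mmap !rmorph_sum; apply: eq_bigr => m _ /=.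
  rewrite !rmorphM /= mmapC mmap1_id mmapX -/(f _) rf; congr (_ * _).
  by rewrite /mmap1 rmorph_prod; apply: eq_bigr => i _; rewrite rmorphXn TE.
exists (range ev); split.
  split; first split.
  - by exists 1 => //; rewrite rmorph1.
  - by move=> _ _ [q _ <-] [q' _ <-]; exists (q - q'); rewrite ?rmorphB.
  - by move=> _ _ [q _ <-] [q' _ <-]; exists (q * q'); rewrite ?rmorphM.
  move=> _ [q _ <-]; rewrite resev => /talg q0.
  apply: ideal_sum => // m _; apply: (idealMr _ hN).
  have /hk.2 : resA q@_m = 0 by rewrite -mcoeff_map_mpoly q0 mcoeff0.
  have [N0 ND NM] := hN; apply: (span_min (I := [set a | N (f a)])).
    split=> [|a b Na Nb|a b Nb]; rewrite /mkset.
    - by rewrite (rmorph0 f).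
    - by rewrite (rmorphD f); apply: ND.
    - by rewrite (rmorphM f); apply: NM.
  by move=> _ ->; rewrite /mkset (rmorph_nat f).
  by move=> a; exists a%:MP => //; rewrite /ev /= mmapC.
move=> kappa; have [P [PF Pr Ps]] := tsep kappa (sK kappa).
exists P; split=> // i F Fdiv FG; apply: (PF i F Fdiv).
  move=> a; have [hs _] := hk; have [b <-] := hs a.
  rewrite -rf; apply: FG; exists b%:MP => //; by rewrite /ev /= mmapC.
move=> _ /(nthP 0) [j jt <-].
rewrite -(TE (Ordinal jt)); apply: FG; exists 'X_(Ordinal jt) => //.
by rewrite /ev /= mmapX mmap1U.
Qed.

(** The hypothesis says that y is independent of J modulo the square of the
    maximal ideal of R_Q.  By Zorn there is a maximal ideal N among those
    containing J and this square but not y; by maximality the maximal ideal is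
    N + R_Q y.  With a coefficient subring G, every s is g + c y + n, where the
    class of c in K is unique; this class is the derivative of s. *)
Lemma residue_derivation_exists (J : set R) (y : R) :
    is_ideal J -> J p%:R -> J `<=` Q -> Q y ->
    (forall u, ~ Q u -> ~ exists2 j, J j & ideal_power Q 2 (u * y - j)) ->
  exists D, [/\ residue_derivation D, forall x, J x -> D x = 0 & D y = 1].
Proof.
move=> hJ Jp JQ Qy ny.
pose I := [set x | exists2 j, J j & ideal_power Q 2 (x - j)].
have [Q20 Q2D Q2M] := power_ideal Q 2.
have hI : is_ideal I.
  have [J0 JD JM] := hJ; split=> [|x z [j Jj xj] [i Ji zi]|a x [j Jj xj]].
  - by exists 0; rewrite ?subr0.
  - by exists (j + i); [apply: JD | rewrite opprD addrACA; apply: Q2D].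
  - by exists (a * j); [apply: JM | rewrite -mulrBr; apply: Q2M].
have IJ x : J x -> I x by move=> Jx; exists x; rewrite // subrr.
have IQ2 x : ideal_power Q 2 x -> I x by exists 0; [case: hJ | rewrite subr0].
have hI' : is_ideal (extended Q loc I) by apply: extended_ideal.
have res0 s := residue0 hQ hloc hK s.
have res_unit s := residue_unit hQ hloc hK (s := s).
pose z := loc y.
have resz : resQ z = 0 by apply/rho0.
have [|F FP totF [X0 FX0]|N [IN [hN Nz] maxN]] := @zorn_extend S
    [set N | is_ideal N /\ ~ N z] (extended Q loc I).
- by split=> //= /(extended_loc hQ hloc _ hI) [u nu]; apply: ny.
- have FU a b : (\bigcup_(X in F) X) a -> (\bigcup_(X in F) X) b ->
      exists X, [/\ F X, X a & X b].
    move=> [X FX Xa] [Y FY Yb].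
    by case: (totF X Y FX FY) => XY; [exists Y | exists X]; split=> //; apply: XY.
  split; last by move=> [X /FP [_ nX] Xz].
  split.
  + by exists X0 => //; have [[]] := FP _ FX0.
  + move=> a b /FU h /h [X [FX Xa Xb]]; exists X => //.
    by have [[_ XD _] _] := FP _ FX; apply: XD.
  + move=> a b [X FX Xb]; exists X => //.
    by have [[_ _ XM] _] := FP _ FX; apply: XM.
have [N0 ND NM] := hN.
have Nres s : N s -> resQ s = 0.
  move=> Ns; apply/eqP; apply: contrapT => /negP /res_unit [t st].
  by apply: Nz; rewrite -[z]mul1r -st mulrC mulrA; apply: (idealMr _ hN); rewrite mulrC; apply: (idealMr _ hN).
have Nsqr s t : resQ s = 0 -> resQ t = 0 -> N (s * t).
  move=> /res0 [u [a [nu Qa sE]]] /res0 [v [b [nv Qb tE]]]; apply: IN.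
  exists (u * v), (a * b); split; first exact: QP.
    by apply: IQ2; rewrite -[2%N]/(1 + 1)%N; apply: powerM; apply: power_mem.
  by rewrite !rmorphM -sE -tE mulrACA.
(* N + S x contains z by maximality, and then x is a multiple of z modulo N *)
have max_z x : resQ x = 0 -> exists c, N (x - c * z).
  move=> rx; have [Nx|nNx] := pselect (N x); first by exists 0; rewrite mul0r subr0.
  pose N' := [set s | exists c, N (s - c * x)].
  have hN' : is_ideal N'.
    split=> [|s t [c sc] [d td]|a s [c sc]].
    - by exists 0; rewrite mul0r subr0.
    - by exists (c + d); rewrite mulrDl opprD addrACA; apply: ND.
    - by exists (a * c); rewrite -mulrA -mulrBr; apply: NM.
  have [c zc] : N' z.
    apply: contrapT => nz; apply: nNx; apply: (maxN N') => //.
      by move=> s Ns; exists 0; rewrite mul0r subr0.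
    by exists 1; rewrite mul1r subrr.
  have [c0|/res_unit [d cd]] := eqVneq (resQ c) 0.
    by case: Nz; apply: (ideal_subK hN zc); apply: Nsqr.
  exists d; have -> : x - d * z = (- d) * (z - c * x).
    by rewrite -{1}[x]mul1r -cd; ring.
  exact: NM.
have Np : N p%:R by rewrite -(rmorph_nat loc); apply/IN/(extended_mem hQ)/IJ.
have [G0 [hG0 AG0 sepG0]] := transcendental_coefficients hN Np.
have [G [G0G [sG GN] Gsurj]] :=
  coefficient_subring (residue_surj hK) res_unit hN Nsqr hG0 sepG0.
have [G1 GB GM] := sG; have GD := subringD sG.
(* s = g + c z modulo N, and the class of c is the derivative of s *)
pose Drel s kappa := exists g c, [/\ G g, resQ c = kappa & N (s - g - c * z)].
have Dex s : exists kappa, Drel s kappa.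
  have [g Gg gs] := Gsurj (resQ s).
  have [|c sc] := max_z (s - g); first by rewrite rmorphB gs subrr.
  by exists (resQ c), g, c.
have Duniq s kappa kappa' : Drel s kappa -> Drel s kappa' -> kappa = kappa'.
  move=> [g [c [Gg <- sc]]] [g' [c' [Gg' <- sc']]].
  have Nd : N ((g - g') + (c - c') * z).
    have -> : (g - g') + (c - c') * z = (s - g' - c' * z) - (s - g - c * z) by ring.
    exact: idealB.
  have Ng : N (g - g').
    apply: GN; first exact: GB.
    by have := Nres _ Nd; rewrite rmorphD rmorphM resz mulr0 addr0.
  apply/eqP; rewrite -subr_eq0 -rmorphB; apply: contrapT => /negP /res_unit [d cd].
  apply: Nz; have -> : z = d * ((g - g' + (c - c') * z) - (g - g')).
    by rewrite -{1}[z]mul1r -cd; ring.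
  by apply: NM; apply: idealB.
have [d dP] := choice Dex.
have dE s kappa : Drel s kappa -> d s = kappa by move=> h; apply: Duniq h.
exists (d \o loc); split=> [|x Jx|] /=.
- split=> [a b|a b|a] /=.
  + apply: dE; have [g [c [Gg <- ac]]] := dP (loc a).
    have [g' [c' [Gg' <- bc]]] := dP (loc b).
    exists (g + g'), (c + c'); split; [exact: GD | by rewrite rmorphD |].
    have -> : loc (a + b) - (g + g') - (c + c') * z =
       (loc a - g - c * z) + (loc b - g' - c' * z) by rewrite rmorphD; ring.
    exact: ND.
  + apply: dE; have [g [c [Gg cd ac]]] := dP (loc a).
    have [g' [c' [Gg' cd' bc]]] := dP (loc b).
    have rg s' h e : N (s' - h - e * z) -> resQ s' = resQ h.
      move=> /Nres; rewrite !rmorphB rmorphM resz mulr0 subr0 => /eqP.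
      by rewrite subr_eq0 => /eqP.
    exists (g * g'), (g * c' + c * g'); split; first exact: GM.
      by rewrite rmorphD !rmorphM /= (rg _ _ _ ac) (rg _ _ _ bc) cd cd'.
    set n1 := loc a - g - c * z in ac; set n2 := loc b - g' - c' * z in bc.
    have -> : loc (a * b) - g * g' - (g * c' + c * g') * z =
       c * c' * (z * z) + n1 * loc b + (g + c * z) * n2.
      by rewrite rmorphM /n1 /n2; ring.
    apply: (ND); last exact: NM.
    apply: (ND); last exact: idealMr.
    by apply: NM; apply: Nsqr.
  + apply: dE; exists (loc a%:A), 0; split; last by rewrite subrr mul0r subr0.
      exact/G0G/AG0.
    exact: rmorph0.
- apply: dE; exists 0, 0; split; [exact: subring0 | exact: rmorph0 |].
  by rewrite mul0r !subr0; apply: IN; apply: (extended_mem hQ); apply: IJ.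
- apply: dE; exists 0, 1; split; [exact: subring0 | exact: rmorph1 |].
  by rewrite mul1r subr0 subrr.
Qed.

(** D is determined by its values on finitely many generators, whose denominators
    in R/Q can be cleared simultaneously. *)
Lemma residue_derivation_scaled (D : R -> K) : residue_derivation D ->
  exists u (e : R -> R), ~ Q u /\ forall x, rho (e x) = rho u * D x.
Proof.
move=> [DD DM DA]; have [C [M [l [[gs gsP] _ [lU lS _]]]]] := Rfin.
have [u nu uP] : exists2 u, ~ Q u &
    forall c, c \in gs -> exists r, rho r = rho u * D (l c).
  elim: gs {gsP} => [|c gs [u nu uP]]; first by exists 1 => //; case: hQ.
  have [v [x [nv E]]] := residue_frac hloc hK (D (l c)).
  exists (v * u); first exact: QP.
  move=> d; rewrite in_cons => /orP [/eqP ->|/uP [r rE]].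
    exists (u * x); rewrite !(rmorphM rho).
    have -> : rho x = D (l c) * rho v by exact: esym E.
    ring.
  by exists (v * r); rewrite !(rmorphM rho) rE mulrA.
have uC c : exists r, rho r = rho u * D (l c).
  pose B : {pred C} := fun c => `[< exists r, rho r = rho u * D (l c) >].
  have BP d : reflect (exists r, rho r = rho u * D (l d)) (d \in B) by apply: asboolP.
  apply/BP; apply: gsP; last by move=> d /uP ?; apply/BP.
  split=> [|a x y /BP [r rE] /BP [r' rE']|x y /BP [r rE] /BP [r' rE']]; apply/BP.
  - by exists 0; rewrite (rmorph0 rho) (rmorph1 l) -[1]scale1r DA mulr0.
  - exists (a%:A * r + r'); rewrite (rmorphD rho) (rmorphM rho) rE rE' linearP DD.
    by rewrite -(mulr_algl a (l x)) DM DA mul0r addr0 mulrDr mulrCA.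
  - exists (l x * r' + r * l y); rewrite (rmorphD rho) !(rmorphM rho) rE rE'.
    by rewrite (rmorphM l) DM; ring.
exists u; suff /choice [e eP] : forall x, exists r, rho r = rho u * D x by exists e.
move=> x; have [c [m Mm E]] := lS x; have [y my] := lU m Mm.
have [r rE] := uC c; have [r' rE'] := uC m.
exists (y * (r - x * r')); rewrite (rmorphM rho) (rmorphB rho) (rmorphM rho) rE rE' -E DM.
have ym : rho y * rho (l m) = 1 by rewrite mulrC -(rmorphM rho) my rmorph1.
by transitivity (rho u * (rho y * rho (l m)) * D x); [ring | rewrite ym mulr1].
Qed.

Lemma hasse_schmidt_exists (J : set R) (y : R) (n : nat) :
    formally_smooth R ->
    is_ideal J -> J p%:R -> J `<=` Q -> Q y ->
    (forall u, ~ Q u -> ~ exists2 j, J j & ideal_power Q 2 (u * y - j)) ->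
  exists E, [/\ hasse_schmidt n.+1 E, forall x, J x -> Q (E 1 x) & ~ Q (E 1 y)].
Proof.
move=> smR hJ Jp JQ Qy ny.
have [D [hD DJ Dy]] := residue_derivation_exists hJ Jp JQ Qy ny.
have [u [e [nu eE]]] := residue_derivation_scaled hD; have [DD DM DA] := hD.
have [||||E [hE E1]] := @hasse_schmidt_lift A R Q e n smR QI.
- by case: hQ.
- by move=> a b; apply/rho0; rewrite (rmorphB rho) (rmorphD rho) !eE DD mulrDr subrr.
- move=> a b; apply/rho0; rewrite (rmorphB rho) (rmorphD rho) !(rmorphM rho) !eE DM.
  ring.
- by move=> a; apply/rho0; rewrite eE DA mulr0.
have rE x : rho (E 1%N x) = rho u * D x.
  by apply/eqP; rewrite -eE -subr_eq0 -(rmorphB rho); apply/eqP/rho0.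
exists E; split=> // [x Jx|]; rewrite -rho0 rE.
  by rewrite DJ ?mulr0.
by rewrite Dy mulr1 => /rho0.
Qed.

End ResidueDerivations.

(** * The two inclusions *)

Section MixedPowers.
Variables (p : nat) (pp : prime p) (A : comNzRingType) (R : comAlgType A).
Variables (delta : R -> R) (hdelta : is_p_derivation p delta).
Variables (Q : set R) (hQ : is_prime_ideal Q) (Qp : Q (p%:R : R)).

Let QI : is_ideal Q. Proof. by case: hQ. Qed.

Lemma symb_sub_mixed n : symb Q n.+1 `<=` mixed_power delta Q n.+1.
Proof.
move=> f Sf s t d st hd; apply/(symb1 hQ).
apply: (symb_leq _ (iter_p_derivation_symb pp hdelta hQ Qp s
  (diff_op_symb hQ hd Sf))).
by move: st => /=; lia.
Qed.

Lemma mixed_mul n u f :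
  mixed_power delta Q n f -> mixed_power delta Q n (u * f).
Proof. by move=> Mf s t d st hd; exact: Mf st (diff_op_mulr u hd). Qed.

Lemma mixed_diff_op n r d f : (r <= n)%N -> diff_op r d ->
  mixed_power delta Q n.+1 f -> mixed_power delta Q (n - r).+1 (d f).
Proof.
move=> rn hd Mf s t d' /= st hd'.
have := diff_op_comp hd' hd; apply: Mf => /=; lia.
Qed.

Lemma mixed_leq m n : (m <= n)%N ->
  mixed_power delta Q n.+1 `<=` mixed_power delta Q m.+1.
Proof. by move=> mn f Mf s t d /= st; apply: Mf; rewrite /= (leq_trans st). Qed.

(** If I is contained in J + Q^2 up to the denominator u, then I^n is contained in
    J^n + Q^(n+1) up to u^n. *)
Lemma power_mod_sqr (I J : set R) u n x : is_ideal J -> J `<=` Q ->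
    (forall z, I z -> exists2 j, J j & ideal_power Q 2 (u * z - j)) ->
  ideal_power I n x ->
  exists2 w, ideal_power J n w & ideal_power Q n.+1 (u ^+ n * x - w).
Proof.
move=> hJ JQ IJ; elim: n x => [|n IH] x.
  move=> _; exists x; first exact: power0.
  by rewrite expr0 mul1r subrr; have [] := power_ideal Q 1.
have [J0 JD JM] := power_ideal J n.+1; have [Q0 QD QM] := power_ideal Q n.+2.
suff sub : ideal_power I n.+1 `<=` [set x | exists2 w, ideal_power J n.+1 w &
    ideal_power Q n.+2 (u ^+ n.+1 * x - w)] by move=> /sub.
apply: powerS_min.
  split=> [|a b [v Jv av] [w Jw bw]|a b [w Jw bw]].
  - by exists 0; rewrite ?mulr0 ?subr0.
  - by exists (v + w); [exact: JD | rewrite mulrDr opprD addrACA; exact: QD].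
  - by exists (a * w); [exact: JM | rewrite mulrCA -mulrBr; exact: QM].
move=> a b /IJ [j Jj aj] /IH [w Jw bw].
exists (j * w); first by rewrite -add1n; apply: powerM => //; apply: power_mem.
have -> : u ^+ n.+1 * (a * b) - j * w =
    j * (u ^+ n * b - w) + (u * a - j) * (u ^+ n * b) by rewrite exprS; ring.
apply: (QD).
  by rewrite -add1n; apply: powerM bw; apply: power_mem; apply: JQ.
rewrite -[n.+2]/(2 + n)%N; apply: powerM aj _.
have PI := power_ideal Q n; apply: (ideal_subK PI (y := w)).
  exact: (power_leq (leqnSn n)).
exact: power_sub Jw.
Qed.

Variable sm : formally_smooth R.
Variables (S : comNzRingType) (loc : {rmorphism R -> S}).
Hypothesis hloc : is_localization (~` Q) loc.
Variables (K : fieldType) (resQ : {rmorphism S -> K}).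
Hypothesis hK : is_quotient (ideal_span (loc @` Q)) resQ.
Variables (k : fieldType) (resA : {rmorphism A -> k}).
Hypothesis hk : is_quotient (principal (p%:R : A)) resA.
Variables (iota : {rmorphism k -> K}).
Hypothesis hiota : forall a : A, iota (resA a) = resQ (loc (a%:A : R)).
Hypothesis hsep : separable_extension iota.
Hypothesis Rfin : exists C : comAlgType A, exists M : set C, exists l : {lrmorphism C -> R},
        [/\ finitely_generated_algebra C, is_multiplicative_set M
          & is_localization M l].

Lemma mixed_sub_symb n : mixed_power delta Q n.+1 `<=` symb Q n.+1.
Proof.
have [Q0 QD QM] := QI.
have Q1 : ~ Q 1 by case: hQ.
have nQX u m : ~ Q u -> ~ Q (u ^+ m).
  move=> nu; elim: m => [|m IH]; rewrite ?expr0 // exprS.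
  by case: hQ => _ _ Qpr /Qpr [].
elim/ltn_ind: n => n IHn.
have SI := symb_ideal hQ n.+1; have [S0 SD SM] := SI.
have peel ys : (forall y, y \in ys -> Q y) -> forall f, mixed_power delta Q n.+1 f ->
    (exists2 g, ideal_power (gen p%:R ys) n g & symb Q n.+1 (f - g)) -> symb Q n.+1 f.
  elim: ys => [|y ys IHys] ysQ f Mf [g gJ fg].
    have [a ag] := gen_nil_power gJ; rewrite ag {g gJ ag} in fg *.
    have [Qa|nQa] := pselect (Q a).
      apply: (ideal_subK SI fg); apply: (symb_power hQ); rewrite -add1n.
      apply: powerM; first exact: power_mem.
      by have := powerX n (power_mem Qp); rewrite muln1.
    have := iter_p_derivation_unit pp hdelta hQ Qp nQa fg.
    rewrite addrC subrK; case.
    apply: (Mf n 0%N id); rewrite ?addn0 //.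
    by exists 1 => x; rewrite mul1r.
  have Qy : Q y by apply: ysQ; rewrite mem_head.
  have {}ysQ z : z \in ys -> Q z by move=> zys; apply: ysQ; rewrite in_cons zys orbT.
  pose J := gen (p%:R : R) ys; have hJ : is_ideal J by apply: gen_ideal.
  have JQ : J `<=` Q by apply: gen_min.
  (* either y is redundant up to the denominator u, or it can be differentiated *)
  have [[u [nu yJ]]|ny] :=
      pselect (exists u, ~ Q u /\ exists2 j, J j & ideal_power Q 2 (u * y - j)).
    have [|w Jw gw] := power_mod_sqr (u := u) hJ JQ _ gJ.
      move=> z [a Jz]; have [j Jj yj] := yJ; have [_ JD JM] := hJ.
      exists (a * j + u * (z - a * y)); first by apply: JD; apply: JM.
      have -> : u * z - (a * j + u * (z - a * y)) = a * (u * y - j) by ring.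
      by have [_ _ Q2M] := power_ideal Q 2; apply: Q2M.
    apply: (symbK hQ (nQX u n nu)); apply: IHys => //; first exact: mixed_mul.
    exists w => //; have -> : u ^+ n * f - w = u ^+ n * (f - g) + (u ^+ n * g - w) by ring.
    by apply: SD; [apply: SM | apply: symb_power].
  have [|E [hE EJ Ey]] := hasse_schmidt_exists hQ hloc hK hk hiota hsep Rfin
      n sm hJ (gen_base _ _) JQ Qy.
    by move=> u nu yJ; apply: ny; exists u.
  have [c [cJ gE]] := gen_cons_power gJ.
  (* the terms y^i g_i with i > 0 are discarded from the top index downwards *)
  suff down r : (r <= n)%N ->
      symb Q n.+1 (f - \sum_(i < r.+1) y ^+ i * c i) -> symb Q n.+1 f.
    by apply: (down n) => //; rewrite -gE.
  elim: r => [|r IHr] rn {}fg.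
    apply: IHys => //; exists (c 0%N); first by have := cJ 0%N isT; rewrite subn0.
    by move: fg; rewrite big_ord1 expr0 mul1r.
  apply: IHr (ltnW rn) _.
  have hEr : diff_op r.+1 (E r.+1) by apply: hasse_schmidt_diff_op hE _; apply: leqW.
  have SIr := symb_ideal hQ (n.+1 - r.+1).
  have e1 : symb Q (n.+1 - r.+1) (E r.+1 f).
    rewrite subSS -[(n - r)%N](_ : (n - r.+1).+1 = _); last lia.
    by apply: IHn; [lia | apply: mixed_diff_op].
  have e2 := diff_op_symb hQ hEr fg.
  have e3 : symb Q (n.+1 - r.+1) (E r.+1 (\sum_(i < r.+2) y ^+ i * c i)).
    have [_ ED _ _] := hE; have := idealB SIr e1 e2.
    set x := \sum_(i < _) _; have : E r.+1 f = E r.+1 (f - x) + E r.+1 x.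
      by rewrite -ED ?subrK //; apply: leqW.
    by move=> ->; rewrite [_ + E _ x]addrC addrK.
  have e4 := hasse_schmidt_expansion hQ JQ hE EJ rn (leqnSn n) Qy
    (fun i ir => cJ i (leq_trans ir rn)).
  have e5 : symb Q (n.+1 - r.+1) (c r.+1).
    apply: (symbK hQ (nQX _ r.+1 Ey)).
    have := idealB SIr e3 (symb_power hQ e4).
    by rewrite opprB addrC subrK.
  have -> : f - \sum_(i < r.+1) y ^+ i * c i =
      (f - \sum_(i < r.+2) y ^+ i * c i) + y ^+ r.+1 * c r.+1.
    by rewrite [in RHS]big_ord_recr /=; ring.
  apply: SD => //.
  have yr : symb Q r.+1 (y ^+ r.+1).
    by apply: (symb_power hQ); have := powerX r.+1 (power_mem Qy); rewrite muln1.
  by have := symbM hQ yr e5; rewrite subnKC // leqW.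
move=> f Mf.
have [u nu Qnf] : symb Q n f.
  case: n IHn Mf {SI S0 SD SM peel} => [|n] IHn Mf; first exact: symb0.
  by apply: (IHn n) => //; apply: mixed_leq Mf.
have [ys [ysQ gf]] := gen_power_exhaust QI Qp Qnf.
apply: (symbK hQ nu); apply: (peel ys) => //; first exact: mixed_mul.
by exists (u * f); rewrite ?subrr.
Qed.

End MixedPowers.

Theorem theorem3p23 (p : nat) (hp : prime p)
  (A : idomainType)
  (hA : is_ring_Z A
        \/ (discrete_valuation_ring A /\ is_uniformizer (p%:R : A)))
  (R : comAlgType A) (hR : essentially_smooth R)
  (delta : R -> R) (hdelta : is_p_derivation p delta)
  (Q : set R) (hQ : is_prime_ideal Q) (hpQ : Q (p%:R : R))
  (* the local ring R_Q *)
  (RQ : comNzRingType) (loc : {rmorphism R -> RQ})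
  (hloc : is_localization (~` Q) loc)
  (* the field A/pA *)
  (k : fieldType) (resA : {rmorphism A -> k})
  (hk : is_quotient (principal (p%:R : A)) resA)
  (* the field R_Q/QR_Q *)
  (K : fieldType) (resQ : {rmorphism RQ -> K})
  (hK : is_quotient (ideal_span (loc @` Q)) resQ)
  (* the induced field extension *)
  (iota : {rmorphism k -> K})
  (hiota : forall a : A, iota (resA a) = resQ (loc (a%:A : R)))
  (hsep : separable_extension iota) :
  forall n : nat, (1 <= n)%N ->
    symbolic_power loc Q n = mixed_power delta Q n.
Proof.
case=> [//|n] _; have [_ smR Rfin] := hR.
rewrite (symbolic_powerE hQ hloc); apply/seteqP; split.
  exact: (symb_sub_mixed hp).
exact: (mixed_sub_symb hp hdelta hQ hpQ smR hloc hK hk hiota hsep Rfin).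
Qed.
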